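(* Let $k$ be a complex number, let $B=\mathbb{C}[x,y,t;q,q^{-1}]$ be the bosonic Fock space with its action of $\widehat{\mathfrak{sl}}_2$ of level $k$ described in the context, and let $\boldsymbol{1}\in B$ be the highest-weight vector (the constant polynomial $1$). Every vector $\tau\in B$ such that $\tau\otimes\tau$ is in the $\widehat{\mathfrak{sl}}_2$-submodule of $B\otimes B$ (with the diagonal action) generated by $\boldsymbol{1}\otimes\boldsymbol{1}$ satisfies the equation $$\Omega_{(0)}(\tau\otimes\tau)=0.$$
   Context: Put $c=k+1$; $x=(x_1,x_2,\dots)$, $y=(y_1,y_2,\dots)$, $t=(t_1,t_2,\dots)$. Define operators on $B$ for $n>0$ by $$\alpha_{(n)}=\partial_{x_n}+c\,\partial_{y_n}+\partial_{t_n},\quad\alpha_{(-n)}=nx_n,\quad\alpha_{(0)}=q\partial_q,$$ $$\gamma_{(n)}=c\,\partial_{x_n}+\partial_{y_n}-\partial_{t_n},\quad\gamma_{(-n)}=ny_n,\quad\gamma_{(0)}=-q\partial_q,$$ $$\delta_{(n)}=\partial_{x_n}-\partial_{y_n},\quad\delta_{(-n)}=nt_n,\quad\delta_{(0)}=0.$$ For $a$ in the span of $\alpha,\gamma,\delta$ put $a(z)=\sum_{n\in\mathbb{Z}}a_{(n)}z^{-n-1}$, and let $$e^{\pm\delta}(z)=q^{\pm1}\exp\Bigl(\pm\sum_{n>0}t_nz^n\Bigr)\exp\Bigl(\pm\sum_{n>0}\tfrac1n(\partial_{y_n}-\partial_{x_n})z^{-n}\Bigr).$$ With $q=e^{\delta}$,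 $B$ is identified with a subspace of the lattice vertex algebra $V_L$, where $L$ is a lattice containing $\delta$ with $\mathbb{C}\otimes_{\mathbb{Z}}L=\mathrm{span}_{\mathbb{C}}\{\alpha,\gamma,\delta\}$, $|\delta|^2=0$, $|\alpha|^2=|\gamma|^2=(\delta|\alpha)=-(\delta|\gamma)=1$, $(\alpha|\gamma)=c$. For $k=-2$ one has $\gamma=-\alpha$, so in that case $y_n=-x_n$ in $B$ (the operators above respect these relations). The fields $$e(z)={:}\alpha(z)e^{\delta}(z){:},\quad f(z)={:}\gamma(z)e^{-\delta}(z){:},\quad h(z)=k\delta(z)+\alpha(z)-\gamma(z)$$ (in normal ordering, the modes $a_{(n)}$ with $n<0$ are placed on the left and those with $n\ge0$ on the right) have modes, defined by $\phi(z)=\sum_n\phi_{(n)}z^{-n-1}$, which give a representation of the affine Kac–Moody algebra $\widehat{\mathfrak{sl}}_2$ of level $k$ on $B$. The element $a_{(m)}$ ($a\in\mathfrak{sl}_2$, $m\in\mathbb{Z}$) acts diagonally on $B\otimes B$ as $a_{(m)}\otimes1+1\otimes a_{(m)}$. Let $L(z)=\sum_{n\in\mathbb{Z}}L_nz^{-n-2}$ be the Virasoro field with $$L_n=\frac{c-1}4\sum_{m\in\mathbb{Z}}{:}\delta_{(m)}\delta_{(n-m)}{:}+\frac12\sum_{m\in\mathbb{Z}}{:}\delta_{(m)}(\alpha-\gamma)_{(n-m)}{:}+\frac1{4(c+1)}\sum_{m\in\mathbb{Z}}{:}(\alpha+\gamma)_{(m)}(\alpha+\gamma)_{(n-m)}{:},$$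 where for $c=-1$ (that is, $k=-2$) the last term is removed and $\gamma=-\alpha$. The Casimir field on $B\otimes B$ is $$\Omega(z)=e(z)\otimes f(z)+f(z)\otimes e(z)+\tfrac12h(z)\otimes h(z)-k\otimes L(z)-L(z)\otimes k,$$ where $k$ denotes $k$ times the identity operator, and $\Omega_{(0)}=\mathrm{Res}_z\,\Omega(z)$ is the coefficient of $z^{-1}$ in $\Omega(z)$. *)

(* Defs.v *)
From HB Require Import structures.
From mathcomp Require Import all_boot all_order all_algebra finmap.
From mathcomp Require Import boolp classical_sets fsbigop.
From mathcomp.multinomials Require Import monalg.

Set Implicit Arguments.
Unset Strict Implicit.
Unset Printing Implicit Defensive.

Import Order.TTheory GRing.Theory Num.Theory.
Local Open Scope classical_set_scope.
Local Open Scope ring_scope.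

(* Variables are indexed from 0: [X n], [Y n], [T n] are the variables
   $x_{n+1}$, $y_{n+1}$, $t_{n+1}$.  This matches [Negz n], the integer
   $-(n+1)$, and [Posz n.+1], the integer $n+1$. *)
Definition var : choiceType := (nat + nat + nat)%type.
Definition X (n : nat) : var := inl (inl n).
Definition Y (n : nat) : var := inl (inr n).
Definition T (n : nat) : var := inr n.

(* The pair [(m, j)] is the Laurent monomial $m q^j$. *)
Definition mono : choiceType := ({cmonom var} * int)%type.

(* $\mathbb{C}[x,y,t;q,q^{-1}]$ and its tensor square, given by their bases of
   monomials and of pairs of monomials. *)
Notation Fock C := {malg C[mono]}.
Notation Fock2 C := {malg C[(mono * mono)%type]}.

Section Operators.
Variable C : numFieldType.

Definition linext (K : choiceType) (V : lmodType C) (F : K -> V)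
    (p : {malg C[K]}) : V :=
  \sum_(m <- msupp p) p@_m *: F m.

Local Notation Op := (Fock C -> Fock C).

Definition vac : Fock C := << (mone, 0) >>.

Definition mulv (v : var) : Op :=
  linext (fun m : mono => << (mmul (ucm v) m.1, m.2) >> : Fock C).

Definition dv (v : var) : Op :=
  linext (fun m : mono =>
    << (m.1 v)%:R *g (divcm m.1 (ucm v), m.2) >> : Fock C).

Definition mulq (s : int) : Op :=
  linext (fun m : mono => << (m.1, m.2 + s) >> : Fock C).

(* $q\partial_q$ *)
Definition eulerq : Op :=
  linext (fun m : mono => << m.2%:~R *g m >> : Fock C).

(* The coefficient of $w^j$ in $(\sum_{n>0} A_n w^n)^i$, where [A n] stands
   for $A_{n+1}$. *)
Fixpoint pow_coef (A : nat -> Op) (i j : nat) (p : Fock C) : Fock C :=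
  if i is i'.+1 then \sum_(n < j) A n (pow_coef A i' (j - n.+1) p)
  else if j == 0%N then p else 0.

(* The coefficient of $w^j$ in $\exp(\sum_{n>0} A_n w^n)$; the powers $i > j$
   of the series do not contribute to it. *)
Definition exp_coef (A : nat -> Op) (j : nat) (p : Fock C) : Fock C :=
  \sum_(i < j.+1) (i`!%:R)^-1 *: pow_coef A i j p.

(* The mode of index n, i.e. the coefficient of $z^{-n-1}$, of
   $e^{s\delta}(z)$ for [s = 1] or [s = -1].  In this and the following
   infinite sums all but finitely many terms vanish on any given vector, so
   that [\sum_(_ \in _) _] is the sum of the nonzero terms. *)
Definition edelta (s : int) (n : int) : Op := fun p =>
  mulq s (\sum_(ij \in [set ij : nat * nat | ij.1%:Z - ij.2%:Z = - n - 1])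
    exp_coef (fun i u => s%:~R *: mulv (T i) u) ij.1
      (exp_coef (fun i u => (s%:~R / i.+1%:R) *: (dv (Y i) u - dv (X i) u))
        ij.2 p)).

Definition nord (A B : int -> Op) (m j : int) : Op := fun p =>
  if m < 0 then A m (B j p) else B j (A m p).

(* The mode of index n of ${:}A(z)B(z){:}$. *)
Definition nprod (A B : int -> Op) (n : int) : Op := fun p =>
  \sum_(m \in [set: int]) nord A B m (n - m - 1) p.

Section Level.
Variable k : C.

Let c : C := k + 1.

(* $B$ is $\mathbb{C}[x,y,t;q,q^{-1}]$ if $k\neq-2$.  If $k=-2$, its quotient
   by the relations $y_n=-x_n$ is identified with the subspace
   $\mathbb{C}[x,t;q,q^{-1}]$ of polynomials not involving $y$: multiplication
   by $y_n$ is then multiplication by $-x_n$, and $\partial_{y_n}$ is zero on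
   the subspace, so that the formulas for the derivations $\alpha_{(n)}$,
   $\gamma_{(n)}$, $\delta_{(n)}$ ($n>0$) give the derivations they induce on
   the quotient. *)
Definition inB (p : Fock C) : Prop :=
  k = -2 -> forall m n, m \in msupp p -> m.1 (Y n) = 0%N.

Definition muly (n : nat) : Op := fun p =>
  if k == -2 then - mulv (X n) p else mulv (Y n) p.

Definition alpha (m : int) : Op := fun p =>
  match m with
  | Posz 0 => eulerq p
  | Posz n.+1 => dv (X n) p + c *: dv (Y n) p + dv (T n) p
  | Negz n => n.+1%:R *: mulv (X n) p
  end.

Definition gamma (m : int) : Op := fun p =>
  match m with
  | Posz 0 => - eulerq p
  | Posz n.+1 => c *: dv (X n) p + dv (Y n) p - dv (T n) p
  | Negz n => n.+1%:R *: muly n p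
  end.

Definition delta (m : int) : Op := fun p =>
  match m with
  | Posz 0 => 0
  | Posz n.+1 => dv (X n) p - dv (Y n) p
  | Negz n => n.+1%:R *: mulv (T n) p
  end.

Definition e_ : int -> Op := nprod alpha (edelta 1).
Definition f_ : int -> Op := nprod gamma (edelta (-1)).
Definition h_ (n : int) : Op := fun p =>
  k *: delta n p + alpha n p - gamma n p.

Definition quad (A B : int -> Op) (n : int) : Op := fun p =>
  \sum_(m \in [set: int]) nord A B m (n - m) p.

Definition amg (n : int) : Op := fun p => alpha n p - gamma n p.
Definition apg (n : int) : Op := fun p => alpha n p + gamma n p.

Definition L_ (n : int) : Op := fun p =>
  ((c - 1) / 4) *: quad delta delta n p + (1 / 2) *: quad delta amg n p
  + (if c == -1 then 0 else (1 / (4 * (c + 1))) *: quad apg apg n p).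

Definition tens (p r : Fock C) : Fock2 C :=
  linext (fun m => linext (fun m' => << (m, m') >> : Fock2 C) r) p.

(* $A\otimes A'$ for linear operators $A$, $A'$ *)
Definition tensop (A A' : Op) : Fock2 C -> Fock2 C :=
  linext (fun mm : mono * mono => tens (A << mm.1 >>) (A' << mm.2 >>)).

Definition diag (A : Op) (w : Fock2 C) : Fock2 C :=
  tensop A id w + tensop id A w.

(* The $\widehat{\mathfrak{sl}}_2$-submodule generated by [w0]; the central
   element acts by a scalar, so closure under it is automatic. *)
Inductive submodule (w0 : Fock2 C) : Fock2 C -> Prop :=
| submodule_gen : submodule w0 w0
| submodule_lin a u v :
    submodule w0 u -> submodule w0 v -> submodule w0 (a *: u + v)
| submodule_e m u : submodule w0 u -> submodule w0 (diag (e_ m) u)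
| submodule_f m u : submodule w0 u -> submodule w0 (diag (f_ m) u)
| submodule_h m u : submodule w0 u -> submodule w0 (diag (h_ m) u).

(* The mode of index n of $A(z)\otimes A'(z)$. *)
Definition tensmode (A A' : int -> Op) (n : int) (w : Fock2 C) : Fock2 C :=
  \sum_(m \in [set: int]) tensop (A m) (A' (n - m - 1)) w.

(* The coefficient of $z^{-n-1}$ in $\Omega(z)$; that of $L(z)$ is
   $L_{n-1}$. *)
Definition Omega (n : int) (w : Fock2 C) : Fock2 C :=
  tensmode e_ f_ n w + tensmode f_ e_ n w + (1 / 2) *: tensmode h_ h_ n w
  - tensop (fun p => k *: p) (L_ (n - 1)) w
  - tensop (L_ (n - 1)) (fun p => k *: p) w.

End Level.
End Operators.

Arguments vac {C}.

(* Main.v *)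
(* The Casimir field commutes with the diagonal action: the brackets of
   $a_{(m)}$ with the first three terms of $\Omega(z)$ cancel by invariance of
   the Casimir element, except for the central contributions
   $k m z^{m-1} (a(z) \otimes 1 + 1 \otimes a(z))$, which cancel against the last
   two because a(z) is primary of weight 1.  Only the mode $\Omega_{(0)}$ is
   needed, and it involves L(z) through $L_{-1}$, which acts as the translation
   operator: $[L_{-1}, a(z)] = \partial_z a(z)$.  Since $\Omega_{(0)}$ kills
   $1 \otimes 1$, it kills the submodule generated by it.

   The brackets of e, f, h and $L_{-1}$ are computed on modes.  The bracket of e
   with f reduces to the quasi-associativity of the normal ordered product
   ([nprod_assoc]) and to $e^{\delta}(z) e^{-\delta}(z) = 1$.  All of them hold on
   the whole polynomial space, also for $k = -2$, where the operators satisfy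
   $\gamma = -\alpha$ everywhere. *)
Require Import Defs.
From mathcomp Require Import all_boot all_order all_algebra finmap.
From mathcomp Require Import boolp classical_sets fsbigop.
From mathcomp Require Import reals complex.
From mathcomp Require Import ring zify.
From mathcomp.multinomials Require Import monalg.

Set Implicit Arguments.
Unset Strict Implicit.
Unset Printing Implicit Defensive.

Import Defs Order.TTheory GRing.Theory Num.Theory.
Local Open Scope classical_set_scope.
Local Open Scope ring_scope.

(** * Finitely supported sums *)

(** The level arises as an anomaly. In the bracket of $:AE:$ with $:BF:$ a sum of derivative type
    appears with coefficient $\kappa-ab$: $\kappa$ is the contraction of $A$ with $B$, while $-ab$
    is the price of reassociating a normal ordered product. For $e$ with $e$ this is $1-1=0$; for
    $e$ with $f$ it is $c-1=k$, and the sum becomes $\delta$ plus a scalar because $\partial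
    F=-\delta F$ and $FE=1$. The coefficients of $L$ are half the inverse Gram matrix of $\delta$,
    $\alpha-\gamma$, $\alpha+\gamma$. The vector $\alpha+\gamma$ is orthogonal to the other two and
    has norm $2(c+1)$, so at $c=-1$ this direction degenerates; there $\alpha+\gamma$ itself
    vanishes. Identities for vertex operators are drawn from the equation $\partial E=s\delta E$
    instead of from factorials: two solutions with opposite $s$ have a constant product. The
    recurring obstacle is convergence: a sum over modes is finite only on each single vector, so
    every interchange of two sums needs a jointly finite support, obtained from the truncation
    condition in [is_field]. *)

Section FiniteSums.
Variables (I J : choiceType) (U : zmodType).

Definition fin (F : I -> U) := exists s : seq I, forall i, i \notin s -> F i = 0.

Lemma fsumE (s : seq I) (F : I -> U) : uniq s ->
  (forall i, i \notin s -> F i = 0) ->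
  \sum_(i \in [set: I]) F i = \sum_(i <- s) F i.
Proof.
move=> us sF; rewrite (bigfs +%R us); last by move=> i _; apply: sF.
by apply: eq_fsbigl; apply/seteqP; split => x.
Qed.

Lemma finP (F : I -> U) : fin F ->
  exists2 s : seq I, uniq s & forall i, i \notin s -> F i = 0.
Proof.
by case=> s sF; exists (undup s); [exact: undup_uniq|move=> i; rewrite mem_undup; apply: sF].
Qed.

Lemma eq_fin (F G : I -> U) : (forall i, F i = G i) -> fin F -> fin G.
Proof. by move=> FG [s sF]; exists s => i /sF; rewrite FG. Qed.

Lemma fin2 (F G : I -> U) : fin F -> fin G -> exists2 s : seq I, uniq s &
  (forall i, i \notin s -> F i = 0) /\ (forall i, i \notin s -> G i = 0).
Proof.
move=> [s sF] [t tG]; exists (undup (s ++ t)); first exact: undup_uniq.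
by split=> i; rewrite mem_undup mem_cat negb_or => /andP[] // *; [apply: sF|apply: tG].
Qed.

Lemma finD (F G : I -> U) : fin F -> fin G -> fin (fun i => F i + G i).
Proof.
move=> fF fG; have [s _ [sF sG]] := fin2 fF fG.
by exists s => i si; rewrite sF // sG // addr0.
Qed.

Lemma eq_fsum (F G : I -> U) : (forall i, F i = G i) ->
  \sum_(i \in [set: I]) F i = \sum_(i \in [set: I]) G i.
Proof. by move=> FG; apply: eq_fsbigr => i _. Qed.

Lemma fsumD (F G : I -> U) : fin F -> fin G ->
  \sum_(i \in [set: I]) (F i + G i) =
  \sum_(i \in [set: I]) F i + \sum_(i \in [set: I]) G i.
Proof.
move=> fF fG; have [s us [sF sG]] := fin2 fF fG.
rewrite (fsumE us sF) (fsumE us sG) (fsumE us) ?big_split // => i si.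
by rewrite sF // sG // addr0.
Qed.

Lemma fsum1 i0 (F : I -> U) : (forall i, i != i0 -> F i = 0) ->
  \sum_(i \in [set: I]) F i = F i0.
Proof.
by move=> F0; rewrite (@fsumE [:: i0]) ?big_seq1 // => i; rewrite inE; apply: F0.
Qed.

Lemma fsum0 (F : I -> U) : (forall i, F i = 0) -> \sum_(i \in [set: I]) F i = 0.
Proof. by move=> F0; apply: fsbig1 => i _. Qed.

Lemma fsum_bij (h : J -> I) (g : I -> J) (F : I -> U) :
  cancel h g -> cancel g h ->
  \sum_(i \in [set: J]) F (h i) = \sum_(i \in [set: I]) F i.
Proof. by move=> hg gh; rewrite (@reindex_fsbigT _ _ _ _ _ h) //; exists g. Qed.

Lemma fin_inj (h : J -> I) (g : I -> J) (F : I -> U) : cancel h g ->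
  fin F -> exists s : seq J, forall i, i \notin s -> F (h i) = 0.
Proof.
move=> hg [s sF]; exists (map g s) => j js; apply: sF.
by apply: contra js => js; apply/mapP; exists (h j).
Qed.

End FiniteSums.

(** Finite rows and columns would not justify an interchange: with 1 at $(i,i)$ and $-1$ at
    $(i,i+1)$ over the naturals, all rows sum to 0 but column 0 sums to 1. *)
Definition fin_pair (I J : choiceType) (U : zmodType) (F : I -> J -> U) :=
  fin (fun ij : I * J => F ij.1 ij.2).

Section FiniteSums2.
Variables (I J : choiceType) (U : zmodType).
Implicit Type F : I -> J -> U.

(** Only the finitely many columns in [t] matter, so the union of their supports, built by induction
    on [t], bounds the other index. *)
Lemma fin_pair_fib F (t : seq J) : (forall j i, j \notin t -> F i j = 0) ->
  (forall j, fin (F ^~ j)) -> fin_pair F.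
Proof.
move=> tF fF.
have [s sF] : exists s : seq I, forall i j, i \notin s -> j \in t -> F i j = 0.
  elim: t {tF} => [|j t [s sF]]; first by exists [::].
  have [s' s'F] := fF j; exists (s' ++ s) => i j'.
  rewrite mem_cat negb_or inE => /andP[is' is_] /orP[/eqP -> | ]; first exact: s'F.
  exact: sF.
exists [seq (i, j) | i <- s, j <- t] => -[i j] /= ij.
have [jt|jt] := boolP (j \in t); last exact: tF.
apply: sF => //; apply: contra ij => is_.
by apply/allpairsP; exists (i, j).
Qed.

Lemma fin_pair_l F i : fin_pair F -> fin (F i).
Proof.
move=> [s sF]; exists (map snd s) => j js; apply: (sF (i, j)).
by apply: contra js => js; apply/mapP; exists (i, j).
Qed.

Lemma fin_pair_sum F : fin_pair F -> fin (fun i => \sum_(j \in [set: J]) F i j).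
Proof.
move=> [s sF]; exists (map fst s) => i is_; apply: fsum0 => j; apply: (sF (i, j)).
by apply: contra is_ => is_; apply/mapP; exists (i, j).
Qed.

Lemma fsum_exchange F : fin_pair F ->
  \sum_(i \in [set: I]) \sum_(j \in [set: J]) F i j =
  \sum_(j \in [set: J]) \sum_(i \in [set: I]) F i j.
Proof.
move=> [s sF].
pose s1 := undup (map fst s); pose s2 := undup (map snd s).
have s1F i j : i \notin s1 -> F i j = 0.
  rewrite mem_undup => is1; apply: (sF (i, j)).
  by apply: contra is1 => is1; apply/mapP; exists (i, j).
have s2F i j : j \notin s2 -> F i j = 0.
  rewrite mem_undup => is1; apply: (sF (i, j)).
  by apply: contra is1 => is1; apply/mapP; exists (i, j).
have u1 : uniq s1 by exact: undup_uniq.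
have u2 : uniq s2 by exact: undup_uniq.
rewrite (fsumE u1); last by move=> i is1; apply: fsum0 => j; apply: s1F.
rewrite (fsumE u2); last by move=> i is1; apply: fsum0 => j; apply: s2F.
rewrite (eq_bigr (fun i => \sum_(j <- s2) F i j)); last first.
  by move=> i _; apply: fsumE => // j; apply: s2F.
rewrite [RHS](eq_bigr (fun j => \sum_(i <- s1) F i j)); last first.
  by move=> j _; apply: fsumE => // i; apply: s1F.
exact: exchange_big.
Qed.

End FiniteSums2.

Lemma fin_int (U : zmodType) (a b : int) (F : int -> U) :
  (forall i, i < a -> F i = 0) -> (forall i, b <= i -> F i = 0) -> fin F.
Proof.
move=> Fa Fb; exists [seq a + n%:Z | n <- iota 0 `|b - a|%N] => i si.
have [/Fa//|ai] := ltP i a; have [/Fb//|ib] := leP b i.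
case/negP: si; apply/mapP; exists `|i - a|%N; first by rewrite mem_iota; lia.
lia.
Qed.

Section FiniteSumsLin.
Variables (C : pzRingType) (I : choiceType) (U W : lmodType C).

Lemma lin0 (f : U -> W) : linear f -> f 0 = 0.
Proof. by move=> lf; have := lf (-1) 0 0; rewrite scaler0 addr0 scaleN1r addNr. Qed.

Lemma linD (f : U -> W) u v : linear f -> f (u + v) = f u + f v.
Proof. by move=> lf; have := lf 1 u v; rewrite !scale1r. Qed.

Lemma linZ (f : U -> W) a u : linear f -> f (a *: u) = a *: f u.
Proof. by move=> lf; have := lf a u 0; rewrite !addr0 (lin0 lf) addr0. Qed.

Lemma linN (f : U -> W) u : linear f -> f (- u) = - f u.
Proof. by move=> lf; rewrite -scaleN1r (linZ _ _ lf) scaleN1r. Qed.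

Lemma linB (f : U -> W) u v : linear f -> f (u - v) = f u - f v.
Proof. by move=> lf; rewrite (linD _ _ lf) (linN _ lf). Qed.

Lemma lin_sum (K : Type) (r : seq K) (P : pred K) (f : U -> W) (F : K -> U) :
  linear f -> f (\sum_(i <- r | P i) F i) = \sum_(i <- r | P i) f (F i).
Proof.
move=> lf; apply: (big_morph f _ (lin0 lf)) => u v; exact: linD.
Qed.

Lemma fin_lin (f : U -> W) (F : I -> U) : linear f -> fin F -> fin (fun i => f (F i)).
Proof. by move=> lf [s sF]; exists s => i /sF ->; apply: lin0. Qed.

Lemma fsum_lin (f : U -> W) (F : I -> U) : linear f -> fin F ->
  f (\sum_(i \in [set: I]) F i) = \sum_(i \in [set: I]) f (F i).
Proof.
move=> lf /finP[s us sF]; rewrite (fsumE us sF) (fsumE us) ?lin_sum //.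
by move=> i /sF ->; apply: lin0.
Qed.

End FiniteSumsLin.

Section FiniteSumsZ.
Variables (C : comPzRingType) (I : choiceType) (U W : lmodType C).

Lemma scale_lin (a : C) : linear (fun u : U => a *: u).
Proof. by move=> b u v; rewrite scalerDr !scalerA mulrC. Qed.

Lemma finZ a (F : I -> U) : fin F -> fin (fun i => a *: F i).
Proof. exact: (fin_lin (scale_lin a)). Qed.

Lemma fsumZ a (F : I -> U) : fin F ->
  \sum_(i \in [set: I]) a *: F i = a *: \sum_(i \in [set: I]) F i.
Proof. by move=> fF; rewrite (fsum_lin (scale_lin a)). Qed.

End FiniteSumsZ.

Section Step.
Variables (C : pzRingType) (U : lmodType C).

Definition step (i : int) : C := (0 <= i)%R%:R.

(** The scalar is $-1$ on $[0,d)$ if $d\ge0$ and $+1$ on $[d,0)$ if $d<0$. This count of the indices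
    that a shift by [d] carries across 0 produces the weight [d] in [nprod_assoc]. *)
Lemma step_diff (d : int) (u : U) :
  fin (fun i => (step (i - d) - step i) *: u) /\
  \sum_(i \in [set: int]) (step (i - d) - step i) *: u = - d%:~R *: u.
Proof.
pose s := [seq (if 0 <= d then n%:Z else n%:Z + d) | n <- iota 0 `|d|%N].
have us : uniq s.
  rewrite map_inj_uniq ?iota_uniq // => m n; case: ifP => _; lia.
have sF i : i \notin s -> (step (i - d) - step i) *: u = 0.
  move=> si; suff -> : step (i - d) = step i by rewrite subrr scale0r.
  rewrite /step; congr (_ %:R); congr nat_of_bool.
  apply: contraNeq si => ne; apply/mapP.
  by case: (lerP 0 d) => d0; [exists `|i|%N | exists `|i - d|%N]; rewrite ?mem_iota; lia.
have sF' i : i \in s -> (step (i - d) - step i) *: u = (- sgz d)%:~R *: u.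
  move=> /mapP[n]; rewrite mem_iota /step => nd ->.
  case: (lerP 0 d) nd => d0 nd.
    have -> : (0 <= n%:Z - d) = false by lia.
    have -> : (0 <= n%:Z) = true by lia.
    have -> : sgz d = 1 by apply/eqP; rewrite sgz_cp0; lia.
    by rewrite sub0r mulrNz.
  have -> : (0 <= n%:Z + d - d) = true by lia.
  have -> : (0 <= n%:Z + d) = false by lia.
  have -> : sgz d = -1 by apply/eqP; rewrite sgz_cp0; lia.
  by rewrite subr0 opprK.
split; first by exists s.
rewrite (fsumE us sF) (eq_big_seq _ sF') big_const_seq count_predT size_map size_iota.
rewrite iter_addr_0 -scaler_nat scalerA -[X in _ = X *: _]mulrNz; congr (_ *: _).
by rewrite pmulrn -intrM; congr _%:~R; lia.
Qed.

End Step.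

(** * Fields and normal ordered products *)

Section Fields.
Variable C : comPzRingType.
Variable V : lmodType C.
Local Notation Op := (V -> V).
Implicit Types (A B E F : int -> Op) (p : V) (i j m n : int).

(* [nordm] and [nprodm] are [nord] and [nprod] over an arbitrary module:
   working in [Fock C] makes unification unfold finitely supported functions. *)
Definition nordm A B m j : Op := fun p =>
  if m < 0 then A m (B j p) else B j (A m p).

Definition nprodm A B n : Op := fun p =>
  \sum_(m \in [set: int]) nordm A B m (n - m - 1) p.

Definition is_field A := (forall n, linear (A n)) /\
  (forall p, exists N : int, forall n, N <= n -> A n p = 0).

Definition comm A B := forall i j p, A i (B j p) = B j (A i p).

(** Mode form of the simple pole $A(z)E(w)\sim aE(w)/(z-w)$, as between a Heisenberg field and a
    vertex operator. *)
Definition vertex A E (a : C) := forall i j p,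
  A i (E j p) = E j (A i p) + a *: E (i + j) p.

(** Mode form of the double pole $a/(z-w)^2$, that is, of $(A|B)=a$ in a Heisenberg algebra. *)
Definition heis A B (a : C) := forall i j p,
  A i (B j p) = B j (A i p) + (if i + j == 0 then i%:~R * a else 0) *: p.

Lemma linear_id : linear (@id V).
Proof. by []. Qed.

Lemma linear_0 : linear (fun _ : V => 0 : V).
Proof. by move=> a u v; rewrite scaler0 addr0. Qed.

Lemma linear_comp (f g : Op) : linear f -> linear g -> linear (fun p => f (g p)).
Proof. by move=> lf lg a u v; rewrite lg lf. Qed.

Lemma linear_add (f g : Op) : linear f -> linear g -> linear (fun p => f p + g p).
Proof. by move=> lf lg a u v; rewrite lf lg scalerDr addrACA. Qed.

Lemma linear_scale (a : C) (f : Op) : linear f -> linear (fun p => a *: f p).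
Proof. by move=> lf b u v; rewrite lf scalerDr !scalerA mulrC. Qed.

Lemma field_lin A n : is_field A -> linear (A n).
Proof. by case=> lA _; apply: lA. Qed.

Lemma field0 A n : is_field A -> A n 0 = 0.
Proof. by move=> fA; apply: lin0; exact: field_lin. Qed.

Lemma fieldD A n p q : is_field A -> A n (p + q) = A n p + A n q.
Proof. by move=> fA; apply: linD; exact: field_lin. Qed.

Lemma fieldZ A n a p : is_field A -> A n (a *: p) = a *: A n p.
Proof. by move=> fA; apply: linZ; exact: field_lin. Qed.

Lemma fieldN A n p : is_field A -> A n (- p) = - A n p.
Proof. by move=> fA; apply: linN; exact: field_lin. Qed.

Lemma field_unif A (I : eqType) (s : seq I) (P : I -> V) : is_field A ->
  exists N : int, forall n (i : I), N <= n -> i \in s -> A n (P i) = 0.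
Proof.
move=> [_ tA]; elim: s => [|i s [N HN]]; first by exists 0.
have [N' HN'] := tA (P i); exists (Num.max N N') => n i'.
rewrite ge_max => /andP[Nn N'n]; rewrite inE => /orP[/eqP -> | i's].
  exact: HN'.
exact: HN.
Qed.

Lemma is_fieldD A B : is_field A -> is_field B -> is_field (fun n p => A n p + B n p).
Proof.
move=> fA fB; split; first by move=> n; apply: linear_add; apply: field_lin.
move=> p; have [N HN] := fA.2 p; have [N' HN'] := fB.2 p.
exists (Num.max N N') => n; rewrite ge_max => /andP[Nn N'n].
by rewrite HN // HN' // addr0.
Qed.

Lemma is_fieldW A (w : int -> C) : is_field A -> is_field (fun n p => w n *: A n p).
Proof.
move=> fA; split; first by move=> n; apply: linear_scale; apply: field_lin.
by move=> p; have [N HN] := fA.2 p; exists N => n /HN ->; rewrite scaler0.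
Qed.

Lemma is_fieldS A n : is_field A -> is_field (fun i => A (n + i)).
Proof.
move=> fA; split; first by move=> i; apply: field_lin.
by move=> p; have [N HN] := fA.2 p; exists (N - n) => i Ni; apply: HN; lia.
Qed.

Lemma is_field0 : is_field (fun _ _ => 0).
Proof. by split=> [n|p]; [exact: linear_0|exists 0]. Qed.

Lemma is_field1 n (a : C) : is_field (fun i p => (if i == n then a else 0) *: p).
Proof.
split=> [i|p]; first exact/linear_scale/linear_id.
by exists (n + 1) => i ni; rewrite ifF ?scale0r //; apply/eqP; lia.
Qed.

Lemma eq_field A B : (forall n p, A n p = B n p) -> is_field A -> is_field B.
Proof. by move=> AB; suff -> : B = A by []; apply/funext => n; apply/funext. Qed.

Lemma eq_nprod A A' B B' n p :
  (forall m q, A m q = A' m q) -> (forall m q, B m q = B' m q) ->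
  nprodm A B n p = nprodm A' B' n p.
Proof.
move=> HA HB; have -> : A = A' by apply/funext => m; apply/funext.
by have -> : B = B' by apply/funext => m; apply/funext.
Qed.

Lemma nord_lin A B m j : is_field A -> is_field B -> linear (nordm A B m j).
Proof.
move=> fA fB a u v; rewrite /nordm; case: ifP => _.
  by rewrite (field_lin j fB) (field_lin m fA).
by rewrite (field_lin m fA) (field_lin j fB).
Qed.

Lemma nord_fin A B n p : is_field A -> is_field B ->
  fin (fun m => nordm A B m (n - m - 1) p).
Proof.
move=> fA fB; have [N HN] := fA.2 p; have [N' HN'] := fB.2 p.
apply: (@fin_int _ (Num.min 0 (n - N')) (Num.max 0 N)) => m; rewrite /nordm.
  by rewrite lt_min => /andP[-> mn]; rewrite HN' ?(field0 _ fA) //; lia.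
rewrite ge_max => /andP[m0 Nm]; rewrite ltNge m0 /= HN // (field0 _ fB) //.
Qed.

Lemma nprod_field A B : is_field A -> is_field B -> is_field (nprodm A B).
Proof.
move=> fA fB; split.
  move=> n a u v; rewrite /nprodm -fsumZ; last exact: nord_fin.
  rewrite -fsumD; [|exact/finZ/nord_fin|exact: nord_fin].
  by apply: eq_fsum => m; apply: nord_lin.
move=> p; have [N HN] := fA.2 p; have [N' HN'] := fB.2 p.
(* For $m\ge0$ the vector $A_mp$ can be nonzero only if $m<N$; one bound [M] for [B] serves all of
   these vectors. *)
pose s := [seq r%:Z | r <- iota 0 `|N|%N].
have [M HM] := field_unif s (fun i => A i p) fB.
exists (Num.max N' (M + `|N|%:Z + 1)) => n; rewrite ge_max => /andP[N'n Mn].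
apply: fsum0 => m; rewrite /nordm; have [m0|m0] := ltP m 0.
  by rewrite HN' ?(field0 _ fA) //; lia.
have [Nm|mN] := leP N m; first by rewrite HN // (field0 _ fB).
apply: (HM _ m); first lia.
apply/mapP; exists `|m|%N; last lia.
by rewrite mem_iota; lia.
Qed.

(** The order inside a summand depends on the index [m] alone, and the bracket with [Q] keeps this
    index. Hence the Leibniz rule holds with no reordering, whether or not [A'] commutes with
    [B]. *)
Lemma nprod_der (Q : Op) A B A' B' n p : linear Q ->
  is_field A -> is_field B -> is_field A' -> is_field B' ->
  (forall i q, Q (A i q) = A i (Q q) + A' i q) ->
  (forall i q, Q (B i q) = B i (Q q) + B' i q) ->
  Q (nprodm A B n p) = nprodm A B n (Q p) + nprodm A' B n p + nprodm A B' n p.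
Proof.
move=> lQ fA fB fA' fB' QA QB; rewrite /nprodm (fsum_lin lQ); last exact: nord_fin.
rewrite -!fsumD; try by [exact: nord_fin|apply: finD; exact: nord_fin].
apply: eq_fsum => m; rewrite /nordm; case: ifP => _.
  by rewrite QA QB (fieldD _ _ _ fA) addrAC.
by rewrite QB QA (fieldD _ _ _ fB).
Qed.

Lemma nprod_comm (Q : Op) A B n p : linear Q -> is_field A -> is_field B ->
  (forall i q, Q (A i q) = A i (Q q)) -> (forall i q, Q (B i q) = B i (Q q)) ->
  Q (nprodm A B n p) = nprodm A B n (Q p).
Proof.
move=> lQ fA fB QA QB; rewrite /nprodm (fsum_lin lQ); last exact: nord_fin.
by apply: eq_fsum => m; rewrite /nordm; case: ifP => _; rewrite ?QA ?QB ?QA.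
Qed.

Lemma nprodZl A B (a : C) n p : is_field A -> is_field B ->
  nprodm (fun m q => a *: A m q) B n p = a *: nprodm A B n p.
Proof.
move=> fA fB; rewrite /nprodm -fsumZ; last exact: nord_fin.
by apply: eq_fsum => m; rewrite /nordm (fieldZ _ _ _ fB); case: ifP.
Qed.

Lemma nprodZr A B (a : C) n p : is_field A -> is_field B ->
  nprodm A (fun m q => a *: B m q) n p = a *: nprodm A B n p.
Proof.
move=> fA fB; rewrite /nprodm -fsumZ; last exact: nord_fin.
by apply: eq_fsum => m; rewrite /nordm (fieldZ _ _ _ fA); case: ifP.
Qed.

Lemma nprodDl A A' B n p : is_field A -> is_field A' -> is_field B ->
  nprodm (fun m q => A m q + A' m q) B n p = nprodm A B n p + nprodm A' B n p.
Proof.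
move=> fA fA' fB; rewrite /nprodm -fsumD; try exact: nord_fin.
by apply: eq_fsum => m; rewrite /nordm (fieldD _ _ _ fB); case: ifP.
Qed.

Lemma nprod0r A n p : is_field A -> nprodm A (fun _ _ => 0) n p = 0.
Proof. by move=> fA; apply: fsum0 => m; rewrite /nordm (field0 _ fA) if_same. Qed.

Lemma nprod1l B l (a : C) n p : is_field B ->
  nprodm (fun i q => (if i == l then a else 0) *: q) B n p = a *: B (n - l - 1) p.
Proof.
move=> fB; rewrite /nprodm (@fsum1 _ _ l) => [|m /negbTE ml]; rewrite /nordm.
  by rewrite eqxx (fieldZ _ _ _ fB) if_same.
by rewrite ml !scale0r (field0 _ fB) if_same.
Qed.

Lemma nprod1r B l (a : C) n p : is_field B ->
  nprodm B (fun i q => (if i == l then a else 0) *: q) n p = a *: B (n - l - 1) p.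
Proof.
move=> fB; rewrite /nprodm (@fsum1 _ _ (n - l - 1)) => [|m /eqP ml]; rewrite /nordm.
  rewrite (_ : _ == l = true); last by apply/eqP; lia.
  by rewrite (fieldZ _ _ _ fB) if_same.
rewrite (_ : _ == l = false); last by apply/eqP; lia.
by rewrite !scale0r (field0 _ fB) if_same.
Qed.

Lemma nprod_shiftr A B i n p :
  nprodm A (fun m => B (i + m)) n p = nprodm A B (n + i) p.
Proof.
apply: eq_fsum => m; rewrite /nordm.
by rewrite (_ : i + (n - m - 1) = n + i - m - 1) //; lia.
Qed.

Lemma comm_sym A B : comm A B -> comm B A.
Proof. by move=> cAB i j p; rewrite cAB. Qed.

Lemma nprod_commE A B n p : comm A B ->
  nprodm A B n p = \sum_(m \in [set: int]) A m (B (n - m - 1) p).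
Proof. by move=> cAB; apply: eq_fsum => m; rewrite /nordm -cAB if_same. Qed.

Lemma nprodC A B n p : comm A B -> nprodm A B n p = nprodm B A n p.
Proof.
move=> cAB; rewrite (nprod_commE _ _ cAB) (nprod_commE _ _ (comm_sym cAB)).
have g : cancel (fun m => n - m - 1) (fun m => n - m - 1) by move=> m /=; lia.
rewrite -(fsum_bij _ g g); apply: eq_fsum => m; rewrite cAB.
by congr (B _ (A _ _)); lia.
Qed.

Lemma comm_nprod Q A B : is_field Q -> is_field A -> is_field B ->
  comm Q A -> comm Q B -> comm Q (nprodm A B).
Proof.
by move=> fQ fA fB QA QB i j p; apply: nprod_comm => //; exact: field_lin.
Qed.

Lemma nprod_shiftl A B i n p : comm A B ->
  nprodm (fun m => A (i + m)) B n p = nprodm A B (n + i) p.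
Proof.
move=> cAB; rewrite nprodC; last by move=> ? ? ?; rewrite cAB.
by rewrite nprod_shiftr nprodC //; exact: comm_sym.
Qed.

(* Reordering the modes of $B$ past those of $E$ contributes the term
   $b (\mathrm{step}(l) - \mathrm{step}(i))$ to the summand with indices i, l;
   as $F E$ depends on $d = i - l$ only, it adds up to $-b d$. *)
Lemma nprod_assoc B F E (b : C) m n p :
  is_field B -> is_field F -> is_field E -> comm F E -> vertex B E b ->
  nprodm (fun i => nprodm B F (n + i)) E m p =
  nprodm B (nprodm F E) (m + n) p -
    b *: \sum_(d \in [set: int]) d%:~R *: F (n - 1 + d) (E (m - 1 - d) p).
Proof.
move=> fB fF fE cFE vBE.
pose G d := F (n - 1 + d) (E (m - 1 - d) p).
have [NE HE] := fE.2 p; have [NF HF] := fF.2 p.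
have G0 d : m - NE <= d < NF - n + 1 \/ G d = 0.
  have [h|h] := boolP (m - NE <= d < _); [by left|right].
  rewrite /G; have [h'|h'] := leP NE (m - 1 - d); first by rewrite HE // (field0 _ fF).
  rewrite cFE HF ?(field0 _ fE) //; lia.
have finG : fin G.
  by apply: (@fin_int _ (m - NE) (NF - n + 1)) => d hd; have [|//] := G0 d; lia.
pose tgt i l := nordm B (fun j q => F j (E (m - i - 1) q)) l (n + i - l - 1) p.
(* [B] has to cross [E] only when [i] and [l] lie on opposite sides of 0; the sign of the step
   difference records the direction of the crossing. *)
pose cor i l := (b * (step C l - step C i)) *: G (i - l).
have lhsE i : nordm (fun i => nprodm B F (n + i)) E i (m - i - 1) p =
    \sum_(l \in [set: int]) (tgt i l + cor i l).
  rewrite {1}/nordm; case: ifP => i0.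
    apply: eq_fsum => l; rewrite /tgt /cor /step /nordm (leNgt 0 l) (leNgt 0 i) i0.
    case: ifP => l0; first by rewrite subrr mulr0 scale0r addr0.
    rewrite /= subr0 mulr1 vBE (fieldD _ _ _ fF) (fieldZ _ _ _ fF).
    by congr (_ + _ *: F _ (E _ _)); lia.
  rewrite (fsum_lin (field_lin _ fE)); last exact: nord_fin.
  apply: eq_fsum => l; rewrite /tgt /cor /step /nordm (leNgt 0 l) (leNgt 0 i) i0.
  case: ifP => l0; last by rewrite subrr mulr0 scale0r addr0 cFE.
  have -> : G (i - l) = E (l + (m - i - 1)) (F (n + i - l - 1) p).
    by rewrite /G cFE; congr (E _ (F _ _)); lia.
  by rewrite /= sub0r mulrN1 scaleNr cFE vBE addrK.
have fintgt : fin_pair tgt.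
  have [NB HB] := fB.2 p.
  (* The indices on [F] and [E] add up to $m+n-l-2$. For [l] below this bound they cannot both stay
     under [NF] and [NE], and since [F] and [E] commute, one of them then kills [p]. *)
  pose L := Num.min 0 (m + n - 1 - NE - NF).
  have ft : fin (fun l : int => if (l < L) || (Num.max NB 0 <= l) then 0 else 1 : int).
    by apply: (@fin_int _ L (Num.max NB 0)) => l ->; rewrite ?orbT.
  have [t tF] := ft; apply: (fin_pair_fib (t := t)) => [l i /tF /= {tF}|l].
    case: ifP => [h _|_ /eqP]; last by rewrite oner_eq0.
    rewrite /tgt /nordm; case/orP: h => h.
      move: h; rewrite lt_min => /andP[-> h].
      have [h3|h3] := leP NE (m - i - 1).
        by rewrite HE // (field0 _ fF) (field0 _ fB).
      by rewrite cFE HF ?(field0 _ fE) ?(field0 _ fB) //; lia.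
    move: h; rewrite ge_max => /andP[h l0].
    by rewrite ltNge l0 /= HB // (field0 _ fE) (field0 _ fF).
  have fFE q : fin (fun i => F (n + i - l - 1) (E (m - i - 1) q)).
    have [NE' HE'] := fE.2 q; have [NF' HF'] := fF.2 q.
    apply: (@fin_int _ (m - NE') (NF' - n + l + 1)) => i hi.
      by rewrite HE' ?(field0 _ fF) //; lia.
    by rewrite cFE HF' ?(field0 _ fE) //; lia.
  rewrite /tgt /nordm; case: (l < 0); last exact: fFE.
  exact: (fin_lin (field_lin _ fB)).
(* In the coordinates $(i,d)$ with $d=i-l$ the vector factor depends on [d] alone and the scalar
   telescopes in [i], so [step_diff] applies to each column. *)
have fincor : fin_pair (fun i d => (b * (step C (i - d) - step C i)) *: G d).
  have [t tG] := finG; apply: (fin_pair_fib (t := t)) => [d i /tG ->|d].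
    by rewrite scaler0.
  apply: eq_fin (finZ b (step_diff d (G d)).1) => i.
  by rewrite scalerA.
have corE i : \sum_(l \in [set: int]) cor i l =
    \sum_(d \in [set: int]) (b * (step C (i - d) - step C i)) *: G d.
  have g : cancel (fun l => i - l) (fun l => i - l) by move=> l /=; lia.
  rewrite -(fsum_bij _ g g); apply: eq_fsum => l.
  by rewrite /cor (_ : i - (i - l) = l) //; lia.
have fincor_i i : fin (cor i).
  have g : cancel (fun l => i - l) (fun l => i - l) by move=> l /=; lia.
  have [s sF] := fin_inj g (fin_pair_l i fincor).
  exists s => l /sF; rewrite /cor (_ : i - (i - l) = l) //; lia.
rewrite {1}/nprodm (eq_fsum (G := fun i => \sum_(l \in [set: int]) tgt i l +
  \sum_(d \in [set: int]) (b * (step C (i - d) - step C i)) *: G d)); last first.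
  by move=> i; rewrite lhsE -corE; apply: fsumD; [exact: fin_pair_l|exact: fincor_i].
rewrite fsumD; [|exact: fin_pair_sum..].
rewrite (fsum_exchange fintgt) (fsum_exchange fincor); congr (_ + _).
  apply: eq_fsum => l; rewrite /tgt /nordm.
  have e1 i : n + i - l - 1 = (n - l - 1) + i by lia.
  have cFE' q : \sum_(i \in [set: int]) F (n + i - l - 1) (E (m - i - 1) q) =
      nprodm F E (m + n - l - 1) q.
    rewrite (_ : m + n - l - 1 = m + (n - l - 1)); last lia.
    rewrite -nprod_shiftl // nprod_commE; last by move=> ? ? ?; apply: cFE.
    by apply: eq_fsum => i; rewrite e1.
  case: (l < 0); last exact: cFE'.
  rewrite -cFE' (fsum_lin (field_lin _ fB)) //.
  have [NE' HE'] := fE.2 p; have [NF' HF'] := fF.2 p.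
  apply: (@fin_int _ (m - NE') (NF' - n + l + 1)) => i hi.
    by rewrite HE' ?(field0 _ fF) //; lia.
  by rewrite cFE HF' ?(field0 _ fE) //; lia.
rewrite -scaleNr -fsumZ; last first.
  by have [t tG] := finG; exists t => d /tG; rewrite /G => ->; rewrite scaler0.
apply: eq_fsum => d; rewrite -/(G d) scaleNr.
rewrite (eq_fsum (G := fun i => b *: ((step C (i - d) - step C i) *: G d))); last first.
  by move=> i; rewrite scalerA.
have [fd Ed] := step_diff d (G d).
by rewrite fsumZ // Ed scaleNr scalerN.
Qed.

End Fields.

(** * Brackets of normal ordered products *)

Section Commutators.
Variable C : comPzRingType.
Variable V : lmodType C.
Local Notation Op := (V -> V).
Implicit Types (A B E F : int -> Op) (p : V) (i j m n : int).

(** $A_i$ is contracted either with [B], leaving the scalar $i\kappa$ in the single mode $-i$, or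
    with [F], which shifts its mode by $i$. *)
Lemma heis_nprod A B F (a kappa : C) i n p :
  is_field A -> is_field B -> is_field F -> heis A B kappa -> vertex A F a ->
  A i (nprodm B F n p) = nprodm B F n (A i p)
    + ((i%:~R * kappa) *: F (n + i - 1) p + a *: nprodm B F (n + i) p).
Proof.
move=> fA fB fF hAB vAF.
rewrite (nprod_der (A' := fun l q => (if l == - i then i%:~R * kappa else 0) *: q)
  (B' := fun j q => a *: F (i + j) q)) //; first last.
- move=> l q; rewrite hAB (_ : (i + l == 0) = (l == - i)) //.
  by rewrite addrC addr_eq0.
- exact/is_fieldW/is_fieldS.
- exact: is_field1.
- exact: field_lin.
rewrite nprod1l // nprodZr //; last exact: is_fieldS.
by rewrite nprod_shiftr -addrA opprK.
Qed.

Lemma vertex_nprod B E F (b : C) j n p :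
  is_field E -> is_field B -> is_field F -> comm F E -> vertex B E b ->
  E j (nprodm B F n p) = nprodm B F n (E j p) - b *: nprodm F E (n + j) p.
Proof.
move=> fE fB fF cFE vBE.
rewrite (nprod_der (A' := fun l q => (- b) *: E (j + l) q)
  (B' := fun _ _ => 0)) //; first last.
- by move=> i q; rewrite addr0 cFE.
- by move=> i q; rewrite vBE (addrC j) scaleNr addrK.
- exact: is_field0.
- exact/is_fieldW/is_fieldS.
- exact: field_lin.
rewrite nprod0r // addr0 nprodZl //; last exact: is_fieldS.
rewrite nprod_shiftl; last exact: comm_sym.
by rewrite scaleNr (nprodC _ _ cFE).
Qed.

Lemma nprod_wsum F E m n p : is_field F -> is_field E -> comm F E ->
  nprodm (fun d q => d%:~R *: F (n - 1 + d) q) E m p =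
  \sum_(d \in [set: int]) d%:~R *: F (n - 1 + d) (E (m - 1 - d) p).
Proof.
move=> fF fE cFE; apply: eq_fsum => d; rewrite /nordm.
rewrite (fieldZ _ _ _ fE) -cFE if_same.
by congr (_ *: F _ (E _ _)); lia.
Qed.

(** $\kappa$ comes from contracting [A] with [B]. Contracting [A] with [F] leaves $:BF:$ multiplied
    by [E] in the wrong bracketing, and [nprod_assoc] converts it to $:B(FE):$ at the cost of $-ab$
    times the same weighted sum. *)
Lemma comm_nprod_nprod A B E F (a b kappa : C) m n p :
  is_field A -> is_field B -> is_field E -> is_field F -> comm F E ->
  heis A B kappa -> vertex A F a -> vertex B E b ->
  nprodm A E m (nprodm B F n p) = nprodm B F n (nprodm A E m p)
   + (a *: nprodm B (nprodm F E) (m + n) p - b *: nprodm A (nprodm F E) (m + n) p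
   + (kappa - a * b) *:
      \sum_(d \in [set: int]) d%:~R *: F (n - 1 + d) (E (m - 1 - d) p)).
Proof.
move=> fA fB fE fF cFE hAB vAF vBE.
set W := \sum_(d \in _) _.
have fBF : is_field (nprodm B F) by exact: nprod_field.
have fFE : is_field (nprodm F E) by exact: nprod_field.
have fW : is_field (fun d q => d%:~R *: F (n - 1 + d) q).
  exact/is_fieldW/is_fieldS.
have fW' : is_field (fun i q => - kappa *: (i%:~R *: F (n - 1 + i) q)).
  exact: (is_fieldW (fun=> - kappa) fW).
have fBFn : is_field (fun i => nprodm B F (n + i)) by exact: is_fieldS.
have fBFn' : is_field (fun i q => - a *: nprodm B F (n + i) q).
  exact: (is_fieldW (fun=> - a) fBFn).
(* A mode of $:BF:$ is moved through $:AE:$ as a derivation, so [A'] and [B'] carry the signs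
   opposite to those of [heis_nprod] and [vertex_nprod]. *)
rewrite (nprod_der (Q := nprodm B F n)
  (A' := fun i q => - kappa *: (i%:~R *: F (n - 1 + i) q) + - a *: nprodm B F (n + i) q)
  (B' := fun j q => b *: nprodm F E (n + j) q)) //; first last.
- by move=> j q; rewrite (@vertex_nprod B E F b) // subrK.
- move=> i q; rewrite (@heis_nprod A B F a kappa) // scalerA mulNr (mulrC kappa).
  by rewrite (addrAC n) !scaleNr -opprD addrK.
- exact/is_fieldW/is_fieldS.
- exact: is_fieldD.
- exact: field_lin.
rewrite nprodDl // nprodZl // nprodZl // nprodZr //; last exact: is_fieldS.
rewrite nprod_shiftr nprod_wsum // (@nprod_assoc _ _ B F E b) // -/W.
rewrite !scaleNr scalerBr scalerBl !scalerA opprB.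
set x := a *: _; set y := b *: _; set z := kappa *: _; set t := (a * b) *: _.
rewrite [z - t]addrC -!addrA -[LHS]addr0; congr (_ + _).
by rewrite (addrCA y) addKr !addNKr addNr.
Qed.

(** The identity field: the constant term of a series in $z^{-n-1}$ sits at $n=-1$. *)
Definition one_mode (n : int) : Op := fun p => (if n == -1 then 1 else 0) *: p.

Lemma nprod_one B X n p : is_field B -> (forall m q, X m q = one_mode m q) ->
  nprodm B X n p = B n p.
Proof.
move=> fB X1; rewrite (eq_nprod (A' := B) (B' := one_mode)) // nprod1r // scale1r.
by rewrite (_ : n - -1 - 1 = n) //; lia.
Qed.

Definition transl (D : Op) A := forall n p,
  D (A n p) = A n (D p) - n%:~R *: A (n - 1) p.

(* The derivative of the field $A(z)$ has the modes $-n A_{(n-1)}$. *)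
Definition dmode A n : Op := fun p => - n%:~R *: A (n - 1) p.

Lemma is_field_dmode A : is_field A -> is_field (dmode A).
Proof.
move=> fA; apply: (@is_fieldW C V (fun n => A (n - 1)) (fun n => - n%:~R)).
apply: eq_field (is_fieldS (-1) fA) => n p; by rewrite addrC.
Qed.

Lemma nprod_dmode A B n p : is_field A -> is_field B ->
  nprodm (dmode A) B n p + nprodm A (dmode B) n p = dmode (nprodm A B) n p.
Proof.
move=> fA fB.
have fdA := is_field_dmode fA; have fdB := is_field_dmode fB.
have g1 : cancel (fun m : int => m + 1) (fun m : int => m - 1) by move=> m /=; lia.
have g2 : cancel (fun m : int => m - 1) (fun m : int => m + 1) by move=> m /=; lia.
rewrite {1}/nprodm -(fsum_bij _ g1 g2) -fsumD; last exact: nord_fin; last first.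
  have [s sF] := fin_inj g1 (nord_fin n p fdA fB).
  by exists s.
rewrite [RHS]/dmode /nprodm -fsumZ; last exact: nord_fin.
apply: eq_fsum => m.
rewrite (_ : n - (m + 1) - 1 = n - 1 - m - 1); last by lia.
(* Reindexing replaces the sign test on [m] by one on [m + 1]. The tests disagree only at $m=-1$,
   where the coefficient $m+1$ of the first summand vanishes. *)
have [->|m1] := eqVneq m (-1).
  rewrite /nordm /= /dmode addNr oppr0 scale0r (field0 _ fB) add0r.
  rewrite (fieldZ _ _ _ fA); congr (_ *: A _ (B _ _)); first by congr (- _%:~R); lia.
  by lia.
rewrite /nordm (_ : (m + 1 < 0) = (m < 0)); last by lia.
rewrite /dmode addrK (fieldZ _ _ _ fA) (fieldZ _ _ _ fB).
rewrite (_ : n - m - 1 - 1 = n - 1 - m - 1); last by lia.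
have -> : n = (m + 1) + (n - m - 1) :> int by lia.
case: (m < 0); rewrite -scalerDl; congr (_ *: _); rewrite -!opprD -intrD; do ?congr (- _%:~R);
 do ?congr (A _ (B _ _)); do ?congr (B _ (A _ _)); lia.
Qed.

Lemma transl_nprod (D : Op) A B : linear D -> is_field A -> is_field B ->
  transl D A -> transl D B -> transl D (nprodm A B).
Proof.
move=> lD fA fB tA tB n p.
rewrite (nprod_der (A' := dmode A) (B' := dmode B)) //.
- by rewrite -addrA (nprod_dmode n p fA fB) /dmode scaleNr.
- exact: is_field_dmode.
- exact: is_field_dmode.
- by move=> i q; rewrite tA /dmode scaleNr.
- by move=> i q; rewrite tB /dmode scaleNr.
Qed.

(** Writing $d=(n+d)-n$ splits the weighted sum into a mode of $-(\partial F)E$ and one of $-nFE$;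
    then $\partial F=a\delta F$ and $FE=1$ evaluate both. *)
Lemma wsum_one F E (delta : int -> Op) (a : C) m n p :
  is_field F -> is_field E -> is_field delta -> comm F E -> comm delta F ->
  comm delta E -> (forall n p, dmode F n p = a *: nprodm delta F n p) ->
  (forall n p, nprodm F E n p = one_mode n p) ->
  \sum_(d \in [set: int]) d%:~R *: F (n - 1 + d) (E (m - 1 - d) p) =
  - a *: delta (m + n) p - (if m + n == 0 then n%:~R else 0) *: p.
Proof.
move=> fF fE fd cFE cdF cdE dF FE1.
transitivity (nprodm (fun d q => d%:~R *: F (n - 1 + d) q) E m p).
  by rewrite nprod_wsum.
have fdF : is_field (nprodm delta F) by exact: nprod_field.
have fG1 : is_field (fun d q => - a *: nprodm delta F (n + d) q).
  exact: (is_fieldW (fun=> - a) (is_fieldS n fdF)).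
have fG2 : is_field (fun d q => - n%:~R *: F (n - 1 + d) q).
  exact: (is_fieldW (fun=> - n%:~R) (is_fieldS (n - 1) fF)).
rewrite (eq_nprod (A' := fun d q => - a *: nprodm delta F (n + d) q +
   - n%:~R *: F (n - 1 + d) q) (B' := E)) //; last first.
  move=> d q; rewrite scaleNr -dF /dmode addrAC -scaleNr opprK -scalerDl.
  by congr (_ *: _); rewrite -mulrNz -intrD; congr _%:~R; lia.
rewrite nprodDl // (nprodZl (A := fun d => nprodm delta F (n + d))) //; last exact: is_fieldS.
rewrite (nprodZl (A := fun d => F (n - 1 + d))) //; last exact: is_fieldS.
rewrite (nprod_shiftl (A := F)) // FE1 (@nprod_assoc C V delta F E 0) //; last first.
  by move=> i j q; rewrite scale0r addr0.
rewrite scale0r subr0 nprod_one //.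
rewrite /one_mode (_ : (m + (n - 1) == -1) = (m + n == 0)); last by lia.
case: ifP => _; first by rewrite scale1r (scaleNr n%:~R).
by rewrite !scale0r scaler0 subr0 addr0.
Qed.

Lemma heis_quad Q A B (a b : C) i p :
  is_field Q -> is_field A -> is_field B -> heis Q A a -> heis Q B b ->
  Q i (nprodm A B 0 p) = nprodm A B 0 (Q i p)
    + i%:~R *: (a *: B (i - 1) p + b *: A (i - 1) p).
Proof.
move=> fQ fA fB hA hB.
rewrite (nprod_der (A' := fun l q => (if l == - i then i%:~R * a else 0) *: q)
  (B' := fun l q => (if l == - i then i%:~R * b else 0) *: q)) //.
- rewrite (nprod1l _ _ _ _ fB) (nprod1r _ _ _ _ fA) -addrA scalerDr !scalerA.
  by rewrite (_ : 0 - - i - 1 = i - 1) //; lia.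
- exact: field_lin.
- exact: is_field1.
- exact: is_field1.
- by move=> l q; rewrite hA (_ : (i + l == 0) = (l == - i)) // addrC addr_eq0.
- by move=> l q; rewrite hB (_ : (i + l == 0) = (l == - i)) // addrC addr_eq0.
Qed.

Lemma vertex_quad E A B (a b : C) j p :
  is_field E -> is_field A -> is_field B -> vertex A E a -> vertex B E b ->
  E j (nprodm A B 0 p) = nprodm A B 0 (E j p)
    - (a *: nprodm B E j p + b *: nprodm A E j p).
Proof.
move=> fE fA fB hA hB.
have fEj : is_field (fun i => E (j + i)) by exact: is_fieldS.
rewrite (nprod_der (A' := fun l q => - a *: E (j + l) q)
  (B' := fun l q => - b *: E (j + l) q)) //; first last.
- by move=> l q; rewrite hB (addrC j) scaleNr addrK.
- by move=> l q; rewrite hA (addrC j) scaleNr addrK.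
- exact: (is_fieldW (fun=> - b) fEj).
- exact: (is_fieldW (fun=> - a) fEj).
- exact: field_lin.
rewrite (nprodZl (A := fun i => E (j + i))) // (nprodZr (B := fun i => E (j + i))) //.
rewrite nprod_shiftr (add0r j) -addrA opprD !scaleNr; congr (_ + (- (_ *: _) + _)).
(* The reflection $l\mapsto-1-l$ exchanges negative and nonnegative indices, so it turns the order
   of $:EB:$ into that of $:BE:$ although [E] and [B] need not commute. *)
have g : cancel (fun l : int => -1 - l) (fun l => -1 - l) by move=> l /=; lia.
rewrite /nprodm -(fsum_bij _ g g); apply: eq_fsum => l; rewrite /nordm.
rewrite (_ : 0 - (-1 - l) - 1 = l); last by lia.
rewrite (_ : j + (-1 - l) = j - l - 1); last by lia.
rewrite (_ : (-1 - l < 0) = ~~ (l < 0)); last by lia.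
by case: (l < 0).
Qed.

End Commutators.

(** * The affine and Virasoro relations *)

Section Sugawara.
Variables (C : numFieldType) (V : lmodType C).
Local Notation Op := (V -> V).
Implicit Types (A B Q : int -> Op) (p : V) (i j m n : int).

Lemma heis_sym A B (a : C) : heis A B a -> heis B A a.
Proof.
move=> hAB i j p; rewrite hAB (addrC j) -addrA -scalerDl.
case: eqP => [ij|_]; last by rewrite addr0 scale0r addr0.
by rewrite -mulrDl -intrD (addrC j) ij mul0r scale0r addr0.
Qed.

Lemma heisD Q A B (a b : C) : is_field Q -> heis Q A a -> heis Q B b ->
  heis Q (fun n p => A n p + B n p) (a + b).
Proof.
move=> fQ hA hB i j p; rewrite (fieldD _ _ _ fQ) hA hB addrACA -scalerDl.
by case: eqP => _; rewrite ?addr0 // -mulrDr.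
Qed.

Lemma heisZ Q A (a b : C) : is_field Q -> heis Q A a ->
  heis Q (fun n p => b *: A n p) (b * a).
Proof.
move=> fQ hA i j p; rewrite (fieldZ _ _ _ fQ) hA scalerDr scalerA.
by case: eqP => _; rewrite ?mulr0 // mulrCA.
Qed.

Lemma heisB Q A B (a b : C) : is_field Q -> heis Q A a -> heis Q B b ->
  heis Q (fun n p => A n p - B n p) (a - b).
Proof.
move=> fQ hA hB i j p; rewrite (fieldD _ _ _ fQ) (fieldN _ _ fQ) hA hB opprD.
rewrite addrACA -scaleNr -scalerDl.
by case: eqP => _; rewrite ?subr0 // mulrBr.
Qed.

Lemma is_fieldB A B : is_field A -> is_field B -> is_field (fun n p => A n p - B n p).
Proof.
move=> fA fB; apply: eq_field (is_fieldD fA (is_fieldW (fun=> -1) fB)) => n p.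
by rewrite scaleN1r.
Qed.

Lemma vertexD A B E (a b : C) : is_field E -> vertex A E a -> vertex B E b ->
  vertex (fun n p => A n p + B n p) E (a + b).
Proof.
by move=> fE hA hB i j p; rewrite (fieldD _ _ _ fE) hA hB addrACA -scalerDl.
Qed.

Lemma vertexB A B E (a b : C) : is_field E -> vertex A E a -> vertex B E b ->
  vertex (fun n p => A n p - B n p) E (a - b).
Proof.
move=> fE hA hB i j p; rewrite (fieldD _ _ _ fE) (fieldN _ _ fE) hA hB opprD.
by rewrite addrACA -scaleNr -scalerDl.
Qed.

Variables (k : C) (alpha gamma delta E F : int -> Op).
Let c : C := k + 1.

Hypotheses (fa : is_field alpha) (fg : is_field gamma) (fd : is_field delta).
Hypotheses (fE : is_field E) (fF : is_field F).
Hypotheses (haa : heis alpha alpha 1) (hag : heis alpha gamma c)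
  (hgg : heis gamma gamma 1) (hda : heis delta alpha 1)
  (hdg : heis delta gamma (-1)) (hdd : heis delta delta 0).
Hypotheses (vaE : vertex alpha E 1) (vaF : vertex alpha F (-1))
  (vgE : vertex gamma E (-1)) (vgF : vertex gamma F 1)
  (vdE : vertex delta E 0) (vdF : vertex delta F 0).
Hypotheses (cEE : comm E E) (cFE : comm F E) (cFF : comm F F).
Hypothesis FE1 : forall n p, nprodm F E n p = one_mode n p.
Hypothesis dE : forall n p, dmode E n p = nprodm delta E n p.
Hypothesis dF : forall n p, dmode F n p = - nprodm delta F n p.
Hypothesis apg0 : c = -1 -> forall n p, alpha n p + gamma n p = 0.

Definition em := nprodm alpha E.
Definition fm := nprodm gamma F.
Definition hm n p := k *: delta n p + alpha n p - gamma n p.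
Definition amgm n p := alpha n p - gamma n p.
Definition apgm n p := alpha n p + gamma n p.
(** This is $L_{-1}$: mode 0 of a normal ordered product collects the pairs of indices with sum
    $-1$. *)
Definition Dm p := ((c - 1) / 4) *: nprodm delta delta 0 p
  + (1 / 2) *: nprodm delta amgm 0 p
  + (if c == -1 then 0 else (1 / (4 * (c + 1))) *: nprodm apgm apgm 0 p).

Let fe : is_field em. Proof. exact: nprod_field. Qed.
Let ff : is_field fm. Proof. exact: nprod_field. Qed.
Let fam : is_field amgm. Proof. exact: is_fieldB. Qed.
Let fap : is_field apgm. Proof. exact: is_fieldD. Qed.
Let had : heis alpha delta 1. Proof. exact: heis_sym. Qed.
Let hga : heis gamma alpha c. Proof. exact: heis_sym. Qed.
Let hgd : heis gamma delta (-1). Proof. exact: heis_sym. Qed.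

Lemma em_comm : comm em em.
Proof.
move=> m n p; rewrite /em (@comm_nprod_nprod _ _ alpha alpha E E 1 1 1) //.
by rewrite mulr1 !subrr scale0r !addr0.
Qed.

Lemma fm_comm : comm fm fm.
Proof.
move=> m n p; rewrite /fm (@comm_nprod_nprod _ _ gamma gamma F F 1 1 1) //.
by rewrite mulr1 !subrr scale0r !addr0.
Qed.

(** Here $a=b=-1$ and $\kappa=c$, so the weighted sum has coefficient $c-1=k$; it yields both
    $k\delta$ and the central term. Since $FE=1$, the two other products collapse to $-\gamma$ and
    $\alpha$. *)
Lemma em_fm m n p : em m (fm n p) = fm n (em m p) + hm (m + n) p
  + (if m + n == 0 then m%:~R * k else 0) *: p.
Proof.
rewrite /em /fm (@comm_nprod_nprod _ _ alpha gamma E F (-1) (-1) c) //.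
rewrite (@wsum_one _ _ F E delta (-1)) //; last first.
- by move=> l q; rewrite dF scaleN1r.
- by move=> i j q; rewrite vdE scale0r addr0.
- by move=> i j q; rewrite vdF scale0r addr0.
rewrite (nprod_one _ _ fg FE1) (nprod_one _ _ fa FE1).
rewrite !scaleN1r !opprK scale1r mulrNN mulr1 /c addrK scalerBr scalerA.
rewrite -!addrA; congr (_ + _); set g := gamma _ _.
rewrite (addrCA (- g)) (addrCA (- g) (k *: _)) (addrCA (alpha _ _)).
congr (_ + (_ + (_ + _))); rewrite -scaleNr (addrC m) addr_eq0; congr (_ *: _).
case: eqP => [->|_]; last by rewrite mulr0 oppr0.
by rewrite mulrNz mulrN opprK mulrC.
Qed.

Lemma is_field_hm : is_field hm.
Proof. exact/is_fieldB/fg/is_fieldD/fa/(is_fieldW (fun=> k)). Qed.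

Lemma delta_em m n p : delta m (em n p) = em n (delta m p) + m%:~R *: E (m + n - 1) p.
Proof.
rewrite /em (@heis_nprod _ _ delta alpha E 0 1) //.
by rewrite scale0r addr0 mulr1 (addrC n).
Qed.

(** The simple poles of $\delta,\alpha,-\gamma$ with [E] contribute $0+1+1=2$, and the double poles
    with [alpha] cancel: $k+1-c=0$. *)
Lemma hm_em m n p : hm m (em n p) = em n (hm m p) + 2%:R *: em (m + n) p.
Proof.
rewrite /hm (fieldD _ _ _ fe) (fieldN _ _ fe) (fieldD _ _ _ fe) (fieldZ _ _ _ fe).
rewrite delta_em /em (@heis_nprod _ _ alpha alpha E 1 1) //.
rewrite (@heis_nprod _ _ gamma alpha E (-1) c) // -/em (addrC n).
rewrite mulr1 scale1r scaleN1r scalerDr scalerA mulrDr mulr1 scalerDl (mulrC k).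
set x := _ *: E _ _; set y := _ *: E _ _; set z := em (m + n) p.
rewrite (AC (2*(1*2)*1) (1*3*6*(2*(4*5)))) opprD opprB /= (addrA x).
by rewrite -!addrA (addrA x) addKr scaler_nat mulr2n.
Qed.

(** Because $c=k+1$, [hm] is orthogonal to [alpha] and [gamma]. It pairs to 2 with [delta], so only
    its component $k\delta$ contributes to its norm. *)
Lemma hm_hm : heis hm hm (2%:R * k).
Proof.
have fh := is_field_hm.
have hdh : heis delta hm 2%:R.
  have := heisB fd (heisD fd (heisZ k fd hdd) hda) hdg.
  by rewrite mulr0 add0r opprK.
have hah : heis alpha hm 0.
  have := heisB fa (heisD fa (heisZ k fa had) haa) hag.
  by rewrite mulr1 subrr.
have hgh : heis gamma hm 0.
  have := heisB fg (heisD fg (heisZ k fg hgd) hga) hgg.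
  by rewrite mulrN1 /c addKr subrr.
have := heisB fh (heisD fh (heisZ k fh (heis_sym hdh)) (heis_sym hah)) (heis_sym hgh).
by rewrite addr0 subr0 mulrC.
Qed.

Lemma hm_fm m n p : hm m (fm n p) = fm n (hm m p) - 2%:R *: fm (m + n) p.
Proof.
rewrite /hm (fieldD _ _ _ ff) (fieldN _ _ ff) (fieldD _ _ _ ff) (fieldZ _ _ _ ff).
rewrite /fm (@heis_nprod _ _ delta gamma F 0 (-1)) //.
rewrite (@heis_nprod _ _ alpha gamma F (-1) c) //.
rewrite (@heis_nprod _ _ gamma gamma F 1 1) // -/fm (addrC n).
rewrite scale0r addr0 mulrN1 mulr1 scale1r scaleN1r scalerDr scaleNr scalerN scalerA.
rewrite mulrDr mulr1 scalerDl (mulrC k).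
set x := _ *: F _ _; set y := _ *: F _ _; set z := fm (m + n) p.
rewrite (AC (2*(1*2)*1) (1*3*6*(2*4*5))) /= addKr !opprD .
by rewrite -!addrA (addrCA (- z)) addKr scaler_nat mulr2n opprD.
Qed.

(** With [d], [x], [y] the pairings of a field with $\delta$, $\alpha-\gamma$, $\alpha+\gamma$, this
    is the expansion of the field in the dual basis. It is what the contractions with the quadratic
    terms of [Dm] leave. *)
Definition Rm d x y n p := ((c - 1) / 4) *: (d *: delta n p + d *: delta n p)
  + (1 / 2) *: (d *: amgm n p + x *: delta n p)
  + (if c == -1 then 0 else (1 / (4 * (c + 1))) *: (y *: apgm n p + y *: apgm n p)).

Lemma Dm_linear : linear Dm.
Proof.
apply: linear_add.
  apply: linear_add; apply: linear_scale; apply: field_lin; exact: nprod_field.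
case: eqP => _; first exact: linear_0.
by apply: linear_scale; apply: field_lin; exact: nprod_field.
Qed.

Lemma transl_heis Q (d x y : C) : is_field Q -> heis Q delta d -> heis Q amgm x ->
  heis Q apgm y -> (forall n p, Rm d x y n p = Q n p) -> transl Dm Q.
Proof.
move=> fQ hd hx hy HR n p; rewrite -(HR (n - 1) p).
suff -> : Q n (Dm p) = Dm (Q n p) + n%:~R *: Rm d x y (n - 1) p by rewrite addrK.
rewrite /Dm !(fieldD _ _ _ fQ) !(fieldZ _ _ _ fQ).
rewrite (heis_quad _ _ fQ fd fd hd hd) (heis_quad _ _ fQ fd fam hd hx).
have -> : Q n (if c == -1 then 0 else (1 / (4 * (c + 1))) *: nprodm apgm apgm 0 p) =
  (if c == -1 then 0 else (1 / (4 * (c + 1))) *: nprodm apgm apgm 0 (Q n p)) +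
  n%:~R *: (if c == -1 then 0 else (1 / (4 * (c + 1))) *:
     (y *: apgm (n - 1) p + y *: apgm (n - 1) p)).
  case: eqP => _; first by rewrite (field0 _ fQ) scaler0 addr0.
  by rewrite (fieldZ _ _ _ fQ) (heis_quad _ _ fQ fap fap hy hy) scalerDr !scalerA (mulrC n%:~R).
rewrite /Rm; move: (_ / 4) (1 / 2) (n%:~R) => a b l.
have scaleC (u : V) a' : a' *: (l *: u) = l *: (a' *: u) by rewrite !scalerA mulrC.
rewrite (scalerDr a) (scalerDr b) !scaleC [l *: (_ + _ + _)]scalerDr [l *: (a *: _ + _)]scalerDr.
by rewrite (addrACA (a *: nprodm _ _ _ _)) (addrACA (_ + b *: nprodm _ _ _ _)).
Qed.

Lemma half_double (u : V) : (1 / 2) *: (u + u) = u.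
Proof. by rewrite -mulr2n -scaler_nat scalerA div1r mulVf ?scale1r // pnatr_eq0. Qed.

(** Giving the pairing with $\alpha+\gamma$ as $w(1+c)$ cancels the denominator $c+1$, so that one
    formula covers $c=-1$ too, where [apg0] makes the $w$ term vanish. *)
Lemma Rm_eq d x w n p :
  Rm d x (w * (1 + c)) n p =
  ((c - 1) / 2 * d + x / 2) *: delta n p + (1 / 2) *: (d *: amgm n p + w *: apgm n p).
Proof.
have n2 : (2 : C) != 0 by rewrite pnatr_eq0.
have n4 : (4 : C) != 0 by rewrite pnatr_eq0.
have -> : (1 / 2) *: (d *: amgm n p + w *: apgm n p) = (1 / 2) *: (d *: amgm n p) +
  (if c == -1 then 0 else (1 / 2) *: (w *: apgm n p)).
  rewrite scalerDr; case: eqP => // c1.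
  by rewrite [apgm n p](apg0 c1) !scaler0.
rewrite /Rm [RHS]addrA; congr (_ + _).
  rewrite -scalerDl [(1 / 2) *: (_ + _)]scalerDr !scalerA addrCA addrC -scalerDl.
  congr (_ *: _ + _).
  by field.
case: eqP => // /eqP c1.
have c1' : c + 1 != 0 by rewrite addr_eq0.
by rewrite -scalerDl !scalerA; congr (_ *: _); field; rewrite c1'.
Qed.

Lemma transl_alpha : transl Dm alpha.
Proof.
apply: (transl_heis (d := 1) (x := 1 - c) (y := 1 * (1 + c))) => //.
- exact: heisB.
- by rewrite mul1r; exact: heisD.
move=> n p; rewrite Rm_eq mulr1 -mulrDl (addrC (c - 1)) subrKA subrr mul0r scale0r add0r.
by rewrite !scale1r /amgm /apgm addrACA addNr addr0 half_double.
Qed.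

Lemma transl_gamma : transl Dm gamma.
Proof.
apply: (transl_heis (d := -1) (x := c - 1) (y := 1 * (1 + c))) => //.
- exact: heisB.
- by rewrite mul1r addrC; exact: heisD.
move=> n p; rewrite Rm_eq mulrN1 addNr scale0r add0r.
by rewrite scaleN1r scale1r /amgm /apgm opprB addrA subrK half_double.
Qed.

Lemma transl_delta : transl Dm delta.
Proof.
apply: (transl_heis (d := 0) (x := 1 - (-1)) (y := 0 * (1 + c))) => //.
- exact: heisB.
- by rewrite mul0r -(subrr 1); exact: heisD.
move=> n p; rewrite Rm_eq mulr0 add0r (_ : (1 - -1) / 2 = 1) ?scale1r; last by field.
by rewrite !scale0r addr0 scaler0 addr0.
Qed.

(** As [delta] and [apgm] have weight 0 on [G], only the cross term $\frac12\delta(\alpha-\gamma)$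
    contributes. The weight $2s$ then leaves $s\delta G=\partial G$. *)
Lemma transl_vertex G (s : C) : is_field G -> vertex delta G 0 ->
  vertex amgm G (2 * s) -> vertex apgm G 0 ->
  (forall n p, dmode G n p = s *: nprodm delta G n p) -> transl Dm G.
Proof.
move=> fG hd hx hy dG n p; rewrite -scaleNr -[X in _ + X]/(dmode G n p) dG.
suff -> : G n (Dm p) = Dm (G n p) - s *: nprodm delta G n p by rewrite subrK.
rewrite /Dm !(fieldD _ _ _ fG) !(fieldZ _ _ _ fG).
rewrite (vertex_quad _ _ fG fd fd hd hd) (vertex_quad _ _ fG fd fam hd hx).
rewrite !scale0r !addr0 subr0 add0r scalerBr scalerA div1r mulKf ?pnatr_eq0 //.
rewrite addrA [RHS]addrAC; congr (_ + _).
case: eqP => _; first by rewrite (field0 _ fG).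
rewrite (fieldZ _ _ _ fG) (vertex_quad _ _ fG fap fap hy hy).
by rewrite !scale0r addr0 subr0.
Qed.

Lemma transl_E : transl Dm E.
Proof.
apply: (transl_vertex (s := 1)) => //.
- by rewrite mulr1 -[2]/(1 + 1) -[X in _ + X]opprK; exact: vertexB.
- by rewrite -(subrr 1); exact: vertexD.
- by move=> n p; rewrite scale1r.
Qed.

Lemma transl_F : transl Dm F.
Proof.
apply: (transl_vertex (s := -1)) => //.
- by rewrite mulrN1 opprD; exact: vertexB.
- by rewrite -(addNr 1); exact: vertexD.
- by move=> n p; rewrite scaleN1r.
Qed.

Lemma transl_em : transl Dm em.
Proof. exact: (transl_nprod Dm_linear fa fE transl_alpha transl_E). Qed.

Lemma transl_fm : transl Dm fm.
Proof. exact: (transl_nprod Dm_linear fg fF transl_gamma transl_F). Qed.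

Lemma transl_hm : transl Dm hm.
Proof.
move=> n p; rewrite /hm (linB _ _ Dm_linear) (linD _ _ Dm_linear) (linZ _ _ Dm_linear).
rewrite transl_alpha transl_gamma transl_delta.
rewrite (scalerBr n%:~R) (scalerDr n%:~R) scalerBr !scalerA (mulrC k).
rewrite (addrACA (k *: _)) -opprD (opprB (gamma _ _)) opprB.
by rewrite addrACA [RHS]addrACA [- gamma _ _ + _]addrC (addrC (- (_ + _))) .
Qed.

End Sugawara.

(** * The Casimir field *)

Section Casimir.
Variables (C : numFieldType) (V W : lmodType C) (T : V -> V -> W) (k : C).
Hypotheses (Tl : forall r, linear (T ^~ r)) (Tr : forall p, linear (T p)).
Implicit Types (A B : int -> V -> V) (p r : V) (i j m n : int).

Definition tprod A B p r := \sum_(m \in [set: int]) T (A m p) (B (- m - 1) r).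

Definition casimir (e f h : int -> V -> V) (D : V -> V) p r :=
  tprod e f p r + tprod f e p r + (1 / 2) *: tprod h h p r
  - k *: T p (D r) - k *: T (D p) r.

Lemma tprod_fin A B p r : is_field A -> is_field B ->
  fin (fun m => T (A m p) (B (- m - 1) r)).
Proof.
move=> fA fB; have [N HN] := fA.2 p; have [N' HN'] := fB.2 r.
apply: (@fin_int _ (- N') N) => m hm.
  by rewrite HN' ?(lin0 (Tr _)) //; lia.
by rewrite HN ?(lin0 (Tl _)).
Qed.

Lemma tprod_der A B A' B' (Q : V -> V) (P : W -> W) p r : linear P ->
  (forall p r, P (T p r) = T (Q p) r + T p (Q r)) ->
  is_field A -> is_field B -> is_field A' -> is_field B' ->
  (forall m q, Q (A m q) = A m (Q q) + A' m q) ->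
  (forall m q, Q (B m q) = B m (Q q) + B' m q) ->
  P (tprod A B p r) =
  tprod A B (Q p) r + tprod A B p (Q r) + (tprod A' B p r + tprod A B' p r).
Proof.
move=> lP PQ fA fB fA' fB' hA hB; rewrite /tprod (fsum_lin lP); last exact: tprod_fin.
rewrite -!fsumD; try by [exact: tprod_fin|apply: finD; exact: tprod_fin].
apply: eq_fsum => m; rewrite PQ hA hB (linD _ _ (Tl _)) (linD _ _ (Tr _)).
by rewrite addrACA.
Qed.

(** Translating the summation index moves a shift of modes from one tensor factor to the other.
    Invariance of the Casimir element thereby becomes a cancellation between identical sums. *)
Lemma tprod_shift A B n p r :
  tprod (fun m => A (n + m)) B p r = tprod A (fun m => B (n + m)) p r.
Proof.
have g1 : cancel (fun m : int => m - n) (fun m : int => m + n) by move=> m /=; lia.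
have g2 : cancel (fun m : int => m + n) (fun m : int => m - n) by move=> m /=; lia.
rewrite /tprod -(fsum_bij _ g1 g2); apply: eq_fsum => m.
by congr (T (A _ _) (B _ _)); lia.
Qed.

Lemma tprod1l B n (a : C) p r :
  tprod (fun m q => (if n + m == 0 then a else 0) *: q) B p r = a *: T p (B (n - 1) r).
Proof.
rewrite /tprod (@fsum1 _ _ (- n)) => [|m /eqP mn].
  by rewrite subrr eqxx (linZ _ _ (Tl _)) opprK.
by rewrite (_ : n + m == 0 = false) ?scale0r ?(lin0 (Tl _)) //; apply/eqP; lia.
Qed.

Lemma tprod1r A n (a : C) p r :
  tprod A (fun m q => (if n + m == 0 then a else 0) *: q) p r = a *: T (A (n - 1) p) r.
Proof.
rewrite /tprod (@fsum1 _ _ (n - 1)) => [|m /eqP mn].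
  by rewrite (_ : n + _ == 0 = true) ?(linZ _ _ (Tr _)) //; apply/eqP; lia.
by rewrite (_ : n + _ == 0 = false) ?scale0r ?(lin0 (Tr _)) //; apply/eqP; lia.
Qed.

Lemma tprodZl A B (a : C) p r : is_field A -> is_field B ->
  tprod (fun m q => a *: A m q) B p r = a *: tprod A B p r.
Proof.
move=> fA fB; rewrite /tprod -fsumZ; last exact: tprod_fin.
by apply: eq_fsum => m; rewrite (linZ _ _ (Tl _)).
Qed.

Lemma tprodZr A B (a : C) p r : is_field A -> is_field B ->
  tprod A (fun m q => a *: B m q) p r = a *: tprod A B p r.
Proof.
move=> fA fB; rewrite /tprod -fsumZ; last exact: tprod_fin.
by apply: eq_fsum => m; rewrite (linZ _ _ (Tr _)).
Qed.

Lemma tprodDl A A' B p r : is_field A -> is_field A' -> is_field B ->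
  tprod (fun m q => A m q + A' m q) B p r = tprod A B p r + tprod A' B p r.
Proof.
move=> fA fA' fB; rewrite /tprod -fsumD; [|exact: tprod_fin..].
by apply: eq_fsum => m; rewrite (linD _ _ (Tl _)).
Qed.

Lemma tprodDr A B B' p r : is_field A -> is_field B -> is_field B' ->
  tprod A (fun m q => B m q + B' m q) p r = tprod A B p r + tprod A B' p r.
Proof.
move=> fA fB fB'; rewrite /tprod -fsumD; [|exact: tprod_fin..].
by apply: eq_fsum => m; rewrite (linD _ _ (Tr _)).
Qed.

Lemma tprod0l B p r : tprod (fun _ _ => 0) B p r = 0.
Proof. by apply: fsum0 => m; rewrite (lin0 (Tl _)). Qed.

Lemma tprod0r A p r : tprod A (fun _ _ => 0) p r = 0.
Proof. by apply: fsum0 => m; rewrite (lin0 (Tr _)). Qed.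

(** [P] is the operator that [Q] induces diagonally, and the primed families are brackets with [Q].
    The last premise balances the brackets of the current terms against those of the two $L_{-1}$
    terms. *)
Lemma casimir_der e f h D e' f' h' D' (Q : V -> V) (P : W -> W) p r : linear P ->
  (forall p r, P (T p r) = T (Q p) r + T p (Q r)) ->
  is_field e -> is_field f -> is_field h ->
  is_field e' -> is_field f' -> is_field h' ->
  (forall m q, Q (e m q) = e m (Q q) + e' m q) ->
  (forall m q, Q (f m q) = f m (Q q) + f' m q) ->
  (forall m q, Q (h m q) = h m (Q q) + h' m q) ->
  (forall q, Q (D q) = D (Q q) + D' q) ->
  tprod e' f p r + tprod e f' p r + (tprod f' e p r + tprod f e' p r)
    + (1 / 2) *: (tprod h' h p r + tprod h h' p r) =
    k *: T p (D' r) + k *: T (D' p) r ->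
  P (casimir e f h D p r) = casimir e f h D (Q p) r + casimir e f h D p (Q r).
Proof.
move=> lP PQ fe ff fh fe' ff' fh' he hf hh hD H.
rewrite /casimir !(linB _ _ lP) !(linD _ _ lP) !(linZ _ _ lP).
rewrite (tprod_der p r lP PQ fe ff fe' ff' he hf).
rewrite (tprod_der p r lP PQ ff fe ff' fe' hf he).
rewrite (tprod_der p r lP PQ fh fh fh' fh' hh hh).
rewrite !PQ !hD (linD _ _ (Tl _)) (linD _ _ (Tr _)) !(scalerDr k).
rewrite (scalerDr (1 / 2) (_ + _) (_ + _)) (addrACA (tprod e f _ _ + _)).
rewrite (addrACA (tprod e f _ _ + _ + _)) {}H (scalerDr (1 / 2)).
rewrite !opprD [LHS](AC (2*2*2*2*(1*2)*3)
  ((1*3*5*9*12)*(2*4*6*10*14)*(7*11)*(8*13))) /=.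
by rewrite !subrr !addr0.
Qed.

Variables (e f h : int -> V -> V) (D : V -> V).
Hypotheses (fe : is_field e) (ff : is_field f) (fh : is_field h).
Hypotheses (ee : comm e e)
  (ef : forall m n p, e m (f n p) = f n (e m p) + h (m + n) p
     + (if m + n == 0 then m%:~R * k else 0) *: p)
  (he : forall m n p, h m (e n p) = e n (h m p) + 2%:R *: e (m + n) p)
  (hf : forall m n p, h m (f n p) = f n (h m p) - 2%:R *: f (m + n) p)
  (hh : heis h h (2%:R * k)).
Hypotheses (De : transl D e) (Df : transl D f) (Dh : transl D h).

Lemma transl_der A n q : transl D A -> A n (D q) = D (A n q) + n%:~R *: A (n - 1) q.
Proof. by move=> tA; rewrite tA subrK. Qed.

Let half2 (w : W) : (1 / 2) *: (2%:R *: w) = w.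
Proof. by rewrite scalerA div1r mulVf ?scale1r // pnatr_eq0. Qed.

(** The sums of $e\otimes h$ and $h\otimes e$ arise from $[e,f]=h$ and, with the opposite sign, from
    half of $[e,h]=-2e$. The central term of $[e,f]$ leaves $nk\,e_{(n-1)}$ in either factor, which
    is $k$ times the bracket of $e_{(n)}$ with [D]. *)
Lemma casimir_e n P p r : linear P ->
  (forall p r, P (T p r) = T (e n p) r + T p (e n r)) ->
  P (casimir e f h D p r) = casimir e f h D (e n p) r + casimir e f h D p (e n r).
Proof.
move=> lP Pe; have fen := is_fieldS n fe; have fhn := is_fieldS n fh.
pose one m (q : V) := (if n + m == 0 then n%:~R * k else 0) *: q.
have fone : is_field one.
  apply: eq_field (is_field1 V (- n) (n%:~R * k)) => m q.
  by rewrite /one (addrC n) addr_eq0.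
have fen2 : is_field (fun m q => - 2%:R *: e (n + m) q) by exact: (is_fieldW (fun=> _) fen).
have ffn : is_field (fun m q => h (n + m) q + one m q) by exact: is_fieldD.
apply: (casimir_der (e' := fun _ _ => 0) (f' := fun m q => h (n + m) q + one m q)
  (h' := fun m q => - 2%:R *: e (n + m) q) (D' := fun q => n%:~R *: e (n - 1) q)
  lP Pe) => //.
- exact: is_field0.
- by move=> m q; rewrite addr0 ee.
- by move=> m q; rewrite ef addrA.
- by move=> m q; rewrite he (addrC m) scaleNr addrK.
- by move=> q; rewrite (transl_der _ _ De).
rewrite tprod0l tprod0r add0r addr0.
rewrite (tprodDr p r fe fhn fone) (tprodDl p r fhn fone fe).
rewrite tprod1l tprod1r (tprodZl _ p r fen fh) (tprodZr _ p r fh fen).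
rewrite (linZ _ _ (Tl _)) (linZ _ _ (Tr _)) !scalerA (mulrC k).
rewrite !tprod_shift !scaleNr -opprD -scalerDr scalerN half2.
rewrite addrACA [X in X - _]addrC addrC addrA (addrC (tprod e _ _ _)).
by rewrite -[X in X - _]addrA [X in X - _]addrC addrK addrC.
Qed.

(** The weights $2$ and $-2$ cancel on $e\otimes f$ and on $f\otimes e$. Half of the central value
    $2nk$ matches the bracket with [D]. *)
Lemma casimir_h n P p r : linear P ->
  (forall p r, P (T p r) = T (h n p) r + T p (h n r)) ->
  P (casimir e f h D p r) = casimir e f h D (h n p) r + casimir e f h D p (h n r).
Proof.
move=> lP Ph; have fen := is_fieldS n fe; have ffn := is_fieldS n ff.
pose one m (q : V) := (if n + m == 0 then n%:~R * (2%:R * k) else 0) *: q.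
have fone : is_field one.
  apply: eq_field (is_field1 V (- n) (n%:~R * (2%:R * k))) => m q.
  by rewrite /one (addrC n) addr_eq0.
have fen2 : is_field (fun m q => 2%:R *: e (n + m) q) by exact: (is_fieldW (fun=> _) fen).
have ffn2 : is_field (fun m q => - 2%:R *: f (n + m) q) by exact: (is_fieldW (fun=> _) ffn).
apply: (casimir_der (e' := fun m q => 2%:R *: e (n + m) q)
  (f' := fun m q => - 2%:R *: f (n + m) q)
  (h' := one) (D' := fun q => n%:~R *: h (n - 1) q)
  lP Ph) => //.
- by move=> m q; rewrite hf scaleNr.
- by move=> q; rewrite (transl_der _ _ Dh).
rewrite tprod1l tprod1r.
rewrite (tprodZl _ p r fen ff) (tprodZr _ p r fe ffn).
rewrite (tprodZl _ p r ffn fe) (tprodZr _ p r ff fen).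
rewrite (linZ _ _ (Tl _)) (linZ _ _ (Tr _)) !tprod_shift !scaleNr.
rewrite subrr addNr !add0r -scalerDr scalerA mulrCA -scalerA.
by rewrite div1r mulKf ?pnatr_eq0 // !scalerA (mulrC k) -scalerDr.
Qed.

End Casimir.

Section CasimirSwap.
Variables (C : numFieldType) (V W : lmodType C) (T : V -> V -> W) (k : C).
Hypotheses (Tl : forall r, linear (T ^~ r)) (Tr : forall p, linear (T p)).
Implicit Types (A B : int -> V -> V) (p r : V) (i j m n : int).

(** The automorphism $e\leftrightarrow f$, $h\mapsto-h$ of $\mathfrak{sl}_2$ fixes the Casimir
    element, so the case of [f] is that of [e] for the swapped triple. *)
Lemma casimir_swap (e f h : int -> V -> V) D p r :
  casimir T k f e (fun n q => - h n q) D p r = casimir T k e f h D p r.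
Proof.
rewrite /casimir (addrC (tprod T f e p r)); congr (_ + _ *: _ - _ - _).
by apply: eq_fsum => m; rewrite (linN _ (Tl _)) (linN _ (Tr _)) opprK.
Qed.

Variables (e f h : int -> V -> V) (D : V -> V).
Hypotheses (fe : is_field e) (ff : is_field f) (fh : is_field h).
Hypotheses (cff : comm f f)
  (ef : forall m n p, e m (f n p) = f n (e m p) + h (m + n) p
     + (if m + n == 0 then m%:~R * k else 0) *: p)
  (hf : forall m n p, h m (f n p) = f n (h m p) - 2%:R *: f (m + n) p).
Hypotheses (De : transl D e) (Df : transl D f) (Dh : transl D h).

Lemma casimir_f n P p r : linear P ->
  (forall p r, P (T p r) = T (f n p) r + T p (f n r)) ->
  P (casimir T k e f h D p r) =
  casimir T k e f h D (f n p) r + casimir T k e f h D p (f n r).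
Proof.
move=> lP Pf; rewrite -3!(casimir_swap e f).
apply: casimir_e => //.
- by apply: eq_field (is_fieldW (fun=> -1) fh) => m q; rewrite scaleN1r.
- move=> l m q; rewrite ef (addrC m) (addrAC _ _ (- h _ _)) addrK -addrA -scalerDl.
  case: eqP => [lm|_]; last by rewrite addr0 scale0r addr0.
  by rewrite -mulrDl -intrD (addrC m) lm mul0r scale0r addr0.
- by move=> l m q; rewrite hf opprB addrC (linN _ (field_lin _ ff)) addrC.
Qed.

End CasimirSwap.

(** * Exponentials and vertex operators *)

Lemma triangle_exchange (U : nmodType) (j : nat) (F : nat -> nat -> U) :
  \sum_(n < j) \sum_(l < j - n.+1) F n l = \sum_(l < j) \sum_(n < j - l.+1) F n l.
Proof.
pose G (n l : nat) := if ((n + l).+1 < j)%N then F n l else 0.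
transitivity (\sum_(n < j) \sum_(l < j) G n l).
  apply: eq_bigr => n _; rewrite (big_ord_widen j (F n)) ?leq_subr //.
  rewrite big_mkcond /=; apply: eq_bigr => l _; rewrite /G.
  by congr (if _ then _ else _); lia.
rewrite exchange_big; apply: eq_bigr => l _ /=.
rewrite (big_ord_widen j (F ^~ l)) ?leq_subr // [RHS]big_mkcond /=.
apply: eq_bigr => n _; rewrite /G.
by congr (if _ then _ else _); lia.
Qed.

Section Exponential.
Variables (C : numFieldType) (V : lmodType C).
Implicit Types (p : V) (i j n l : nat).

(** [powm] and [expm] are [pow_coef] and [exp_coef] over an arbitrary module; [A n] is again the
    coefficient of $w^{n+1}$. *)
Fixpoint powm (A : nat -> V -> V) i j p : V :=
  if i is i'.+1 then \sum_(n < j) A n (powm A i' (j - n.+1) p)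
  else if j == 0%N then p else 0.

Definition expm (A : nat -> V -> V) j p : V :=
  \sum_(i < j.+1) (i`!%:R)^-1 *: powm A i j p.

Variable A : nat -> V -> V.
Hypothesis lA : forall n, linear (A n).

Lemma powm_lin i j : linear (powm A i j).
Proof.
elim: i j => [|i IH] j a u v /=; first by case: eqP => // _; rewrite scaler0 addr0.
rewrite scaler_sumr -big_split; apply: eq_bigr => n _ /=.
by rewrite IH (lA n).
Qed.

Lemma expm_lin j : linear (expm A j).
Proof.
move=> a u v; rewrite /expm scaler_sumr -big_split; apply: eq_bigr => i _ /=.
by rewrite powm_lin scalerDr !scalerA mulrC.
Qed.

Lemma powm_comm (Q : V -> V) i j p : linear Q -> (forall n q, Q (A n q) = A n (Q q)) ->
  Q (powm A i j p) = powm A i j (Q p).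
Proof.
move=> lQ QA; elim: i j => [|i IH] j /=; first by case: eqP => // _; rewrite lin0.
by rewrite (lin_sum _ _ _ lQ); apply: eq_bigr => n _; rewrite QA IH.
Qed.

Lemma expm_comm (Q : V -> V) j p : linear Q -> (forall n q, Q (A n q) = A n (Q q)) ->
  Q (expm A j p) = expm A j (Q p).
Proof.
move=> lQ QA; rewrite /expm (lin_sum _ _ _ lQ); apply: eq_bigr => i _.
by rewrite (linZ _ _ lQ) powm_comm.
Qed.

Lemma powm_big i j p : (j < i)%N -> powm A i j p = 0.
Proof.
elim: i j => // i IH j /= ji; apply: big1 => n _.
by rewrite IH ?(lin0 (lA n)) //; have := ltn_ord n; lia.
Qed.

Lemma expm0 p : expm A 0 p = p.
Proof. by rewrite /expm big_ord1 /= invr1 scale1r. Qed.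

Hypothesis cA : forall m n p, A m (A n p) = A n (A m p).

(* Both sides are the coefficients of $w \frac{d}{dw}$ of a power. *)
Lemma powm_deriv i j p : j%:R *: powm A i.+1 j p =
  i.+1%:R *: \sum_(n < j) n.+1%:R *: A n (powm A i (j - n.+1) p).
Proof.
elim: i j => [|i IH] j.
  rewrite scale1r scaler_sumr; apply: eq_bigr => n _ /=.
  case: eqP => [jn|_]; last by rewrite (lin0 (lA n)) !scaler0.
  by congr (_%:R *: _); have := ltn_ord n; lia.
rewrite [powm _ _ _ _]/= scaler_sumr.
transitivity (\sum_(n < j) n.+1%:R *: A n (powm A i.+1 (j - n.+1) p) +
  \sum_(n < j) A n ((j - n.+1)%:R *: powm A i.+1 (j - n.+1) p)).
  rewrite -big_split; apply: eq_bigr => n _ /=; rewrite (linZ _ _ (lA n)) -scalerDl -natrD.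
  by congr (_%:R *: _); have := ltn_ord n; lia.
rewrite [in RHS]mulrS [RHS]scalerDl scale1r; congr (_ + _).
transitivity (\sum_(n < j) \sum_(l < j - n.+1)
   (i.+1%:R * l.+1%:R) *: A l (A n (powm A i (j - n.+1 - l.+1) p))).
  apply: eq_bigr => n _; rewrite IH (linZ _ _ (lA n)) (lin_sum _ _ _ (lA n)) scaler_sumr.
  by apply: eq_bigr => l _; rewrite (linZ _ _ (lA n)) scalerA cA.
rewrite (triangle_exchange j (fun n l => (i.+1%:R * l.+1%:R) *:
  A l (A n (powm A i (j - n.+1 - l.+1) p)))) scaler_sumr.
apply: eq_bigr => l _ /=; rewrite (lin_sum _ _ _ (lA l)) !scaler_sumr.
apply: eq_bigr => n _; rewrite scalerA.
by congr (_ *: A _ (A _ (powm _ _ _ _))); lia.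
Qed.

(** The coefficient of $w^j$ in $w\frac{d}{dw}\exp A=(w\frac{d}{dw}A)\exp A$. In characteristic 0 it
    determines the coefficients for $j>0$ recursively, and it replaces the factorial sum from here
    on. *)
Lemma expm_rec j p :
  j%:R *: expm A j p = \sum_(n < j) n.+1%:R *: A n (expm A (j - n.+1) p).
Proof.
rewrite /expm big_ord_recl scalerDr /= scalerA mulrC -scalerA.
have -> : j%:R *: (if j == 0%N then p else 0) = 0.
  by case: eqP => [->|_]; rewrite ?scale0r ?scaler0.
rewrite scaler0 add0r scaler_sumr.
transitivity (\sum_(i < j) \sum_(n < j)
  (n.+1%:R * (i`!%:R)^-1) *: A n (powm A i (j - n.+1) p)).
  apply: eq_bigr => i _; rewrite scalerA mulrC -scalerA.
  rewrite -[X in _ *: (_ *: X)]/(powm A i.+1 j p) powm_deriv !scalerA scaler_sumr.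
  apply: eq_bigr => n _; rewrite scalerA; congr (_ *: _).
  rewrite /bump /= add1n factS natrM invfM mulrC; congr (_ * _).
  by rewrite mulrC mulrA mulfV ?mul1r // pnatr_eq0.
rewrite exchange_big; apply: eq_bigr => n _ /=.
have nj := ltn_ord n; rewrite subnSK //.
rewrite (lin_sum _ _ _ (lA n)) scaler_sumr.
rewrite [RHS](big_ord_widen j (fun i => n.+1%:R *: A n
   ((i`!%:R)^-1 *: powm A i (j - n.+1) p))) ?leq_subr //.
rewrite [RHS]big_mkcond /=; apply: eq_bigr => i _; rewrite (linZ _ _ (lA n)) scalerA.
case: ltnP => // ij; rewrite powm_big ?(lin0 (lA n)) ?scaler0 //; lia.
Qed.

(** A scalar bracket with a single coefficient makes [Q] act on the exponential as a derivation in
    that coefficient, which pulls down one factor of degree $r+1$. *)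
Lemma expm_bracket (Q : V -> V) (r : nat) (w : C) j p : linear Q ->
  (forall n q, Q (A n q) = A n (Q q) + (if n == r then w else 0) *: q) ->
  Q (expm A j p) = expm A j (Q p) + w *: (if (r < j)%N then expm A (j - r.+1) p else 0).
Proof.
move=> lQ QA; elim/ltn_ind: j => j IH.
have [->|j0] := eqVneq j 0%N; first by rewrite !expm0 scaler0 addr0.
have jn0 : j%:R != 0 :> C by rewrite pnatr_eq0.
apply: (scalerI jn0); rewrite scalerDr expm_rec -(linZ _ _ lQ) expm_rec.
rewrite (lin_sum _ _ _ lQ).
transitivity (\sum_(n < j) n.+1%:R *: A n (expm A (j - n.+1) (Q p)) +
  (\sum_(n < j) n.+1%:R *: A n
     (w *: (if (r < j - n.+1)%N then expm A (j - n.+1 - r.+1) p else 0)) +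
   \sum_(n < j) n.+1%:R *: ((if n == r :> nat then w else 0) *: expm A (j - n.+1) p))).
  rewrite -!big_split; apply: eq_bigr => n _ /=.
  rewrite (linZ _ _ lQ) QA IH; last by have := ltn_ord n; lia.
  by rewrite (linD _ _ (lA n)) !scalerDr addrA.
congr (_ + _); have [rj|jr] := ltnP r j; last first.
  rewrite !scaler0 !big1 ?addr0 // => n _; have nj := ltn_ord n.
    by rewrite ifF ?scale0r ?scaler0 //; lia.
  by rewrite ifF ?scaler0 ?(lin0 (lA n)) ?scaler0 //; lia.
rewrite [X in _ + X](bigD1 (Ordinal rj)) //= eqxx [X in _ + (_ + X)]big1 ?addr0; last first.
  move=> n nr; rewrite ifF ?scale0r ?scaler0 //.
  by apply: contraNF nr => /eqP nr; apply/eqP/val_inj.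
(* The inductive terms add up to weight $j-(r+1)$ and the bracket with [A r] itself has weight
   $r+1$; their sum is the factor $j$ introduced before. *)
transitivity (w *: ((j - r.+1)%:R *: expm A (j - r.+1) p) +
  r.+1%:R *: (w *: expm A (j - r.+1) p)).
  congr (_ + _); rewrite expm_rec scaler_sumr.
  rewrite [RHS](big_ord_widen j (fun n => w *: (n.+1%:R *: A n (expm A (j - r.+1 - n.+1) p))))
    ?leq_subr // [RHS]big_mkcond /=.
  apply: eq_bigr => n _; rewrite (_ : (r < j - n.+1)%N = (n < j - r.+1)%N); last first.
    by have := ltn_ord n; lia.
  case: ifP => _; last by rewrite scaler0 (lin0 (lA n)) scaler0.
  rewrite (linZ _ _ (lA n)) !scalerA mulrC; congr (_ *: A _ (expm _ _ _)); lia.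
rewrite !scalerA -scalerDl (mulrC w) -mulrDl -natrD; congr (_%:R * _ *: _); lia.
Qed.

End Exponential.

(** * Commuting fields determined by a first order differential equation *)

Section CommutingFields.
Variables (C : numFieldType) (V : lmodType C).
Implicit Types (A B X Y G : int -> V -> V) (p : V) (m n : int).

Lemma nprodA A B X n p : is_field A -> is_field B -> is_field X ->
  comm A X -> comm B X ->
  nprodm (nprodm A B) X n p = nprodm A (nprodm B X) n p.
Proof.
move=> fA fB fX cAX cBX.
have := @nprod_assoc _ _ A B X 0 n 0 p fA fB fX cBX.
rewrite scale0r subr0 addr0 => <-; last by move=> i j q; rewrite scale0r addr0.
by apply: eq_nprod => // m q; rewrite add0r.
Qed.

Lemma one_of_dmode X : (forall n p, dmode X n p = 0) -> (forall p, X (-1) p = p) ->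
  forall n p, X n p = one_mode n p.
Proof.
move=> dX X1 n p; rewrite /one_mode; case: eqP => [->|n1]; first by rewrite X1 scale1r.
have := dX (n + 1) p; rewrite /dmode addrK => /eqP.
rewrite scaler_eq0 oppr_eq0 intr_eq0 => /orP[/eqP n0|/eqP ->]; last by rewrite scale0r.
by case: n1; lia.
Qed.

(** Opposite logarithmic derivatives give $\partial(XY)=0$. In characteristic 0 only mode $-1$
    survives, and it is the identity by assumption. *)
Lemma nprod_inverse X Y G (s : C) : is_field X -> is_field Y -> is_field G ->
  comm X Y -> comm G X -> comm G Y ->
  (forall n p, dmode X n p = s *: nprodm G X n p) ->
  (forall n p, dmode Y n p = - s *: nprodm G Y n p) ->
  (forall p, nprodm X Y (-1) p = p) ->
  forall n p, nprodm X Y n p = one_mode n p.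
Proof.
move=> fX fY fG cXY cGX cGY dX dY XY1; apply: one_of_dmode => // n p.
rewrite -nprod_dmode //.
have fGX : is_field (nprodm G X) by exact: nprod_field.
have fGY : is_field (nprodm G Y) by exact: nprod_field.
rewrite (eq_nprod (A := dmode X) (A' := fun n q => s *: nprodm G X n q) (B' := Y)) // nprodZl //.
rewrite (eq_nprod (A' := X) (B := dmode Y) (B' := fun n q => - s *: nprodm G Y n q)) // nprodZr //.
rewrite (nprodA _ _ fG fX fY cGY cXY).
rewrite (nprodC _ _ (comm_nprod fX fG fY (comm_sym cGX) cXY)).
rewrite (nprodA _ _ fG fY fX cGX (comm_sym cXY)).
rewrite (eq_nprod (A' := G) (B' := nprodm X Y) (B := nprodm Y X)) //.
  by rewrite scaleNr subrr.
by move=> m q; apply: nprodC; exact: comm_sym.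
Qed.

End CommutingFields.

(** * The vertex operator of a field with commuting modes *)

Section VertexOperator.
Variables (C : numFieldType) (V : lmodType C) (delta : int -> V -> V).
Hypotheses (fd : is_field delta) (cdd : comm delta delta) (d0 : forall p, delta 0 p = 0).
Implicit Types (s : C) (p : V) (m n : int).

(** The exponents of $e^{s\delta}(z)$: [cre] is $st_n$, because $\delta_{(-n)}=nt_n$, and [ann] is
    $-\frac sn\delta_{(n)}$, with $n=i+1$. *)
Definition cre s (i : nat) p := (s / i.+1%:R) *: delta (Negz i) p.
Definition ann s (i : nat) p := (- s / i.+1%:R) *: delta (Posz i.+1) p.
(** The creation half: $z^j$ is stored at the mode $-j-1$, which is [Negz j]. In [Rmode], the
    annihilation half, $z^{-j}$ sits at the mode $j-1$. *)
Definition Smode s n p := if n is Negz j then expm (cre s) j p else 0.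
Definition Rmode s n p := if n + 1 is Posz j then expm (ann s) j p else 0.
Definition Emode s (q : V -> V) n p := q (nprodm (Smode s) (Rmode s) n p).

Hypothesis fR : forall s, is_field (Rmode s).

Let cre_lin s i : linear (cre s i).
Proof. by apply: linear_scale; exact: field_lin. Qed.

Let ann_lin s i : linear (ann s i).
Proof. by apply: linear_scale; exact: field_lin. Qed.

Let cre_comm s i j p : cre s i (cre s j p) = cre s j (cre s i p).
Proof. by rewrite /cre !(fieldZ _ _ _ fd) cdd !scalerA mulrC. Qed.

Let ann_comm s i j p : ann s i (ann s j p) = ann s j (ann s i p).
Proof. by rewrite /ann !(fieldZ _ _ _ fd) cdd !scalerA mulrC. Qed.

Lemma is_field_S s : is_field (Smode s).
Proof.
split=> [[j|j]|p]; [exact: linear_0|exact: expm_lin|].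
by exists 0; case.
Qed.

Lemma S_comm (Q : V -> V) s n p : linear Q ->
  (forall m q, Q (delta m q) = delta m (Q q)) -> Q (Smode s n p) = Smode s n (Q p).
Proof.
move=> lQ Qd; case: n => j /=; first exact: lin0.
by apply: expm_comm => // i q; rewrite /cre (linZ _ _ lQ) Qd.
Qed.

Lemma R_comm (Q : V -> V) s n p : linear Q ->
  (forall m q, Q (delta m q) = delta m (Q q)) -> Q (Rmode s n p) = Rmode s n (Q p).
Proof.
move=> lQ Qd; rewrite /Rmode; case: (n + 1) => j; last exact: lin0.
by apply: expm_comm => // i q; rewrite /ann (linZ _ _ lQ) Qd.
Qed.

Lemma comm_delta_S s : comm delta (Smode s).
Proof. by move=> i j p; apply: S_comm => [|m q]; [exact: field_lin|exact: cdd]. Qed.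

Lemma comm_delta_R s : comm delta (Rmode s).
Proof. by move=> i j p; apply: R_comm => [|m q]; [exact: field_lin|exact: cdd]. Qed.

Lemma comm_S_S s s' : comm (Smode s) (Smode s').
Proof.
move=> i j p; apply: S_comm => [|m q]; first exact/field_lin/is_field_S.
by rewrite comm_delta_S.
Qed.

Lemma comm_R_R s s' : comm (Rmode s) (Rmode s').
Proof.
move=> i j p; apply: R_comm => [|m q]; first exact/field_lin/fR.
by rewrite comm_delta_R.
Qed.

Lemma comm_S_R s s' : comm (Smode s) (Rmode s').
Proof.
move=> i j p; apply: R_comm => [|m q]; first exact/field_lin/is_field_S.
by rewrite comm_delta_S.
Qed.

Lemma EmodeE s q n p : Emode s q n p =
  q (\sum_(ij \in [set ij : nat * nat | ij.1%:Z - ij.2%:Z = - n - 1])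
    expm (cre s) ij.1 (expm (ann s) ij.2 p)).
Proof.
rewrite /Emode; congr (q _); rewrite /nprodm.
have fS := is_field_S s.
transitivity (\sum_(m \in [set m : int | m < 0 /\ m <= n])
  nordm (Smode s) (Rmode s) m (n - m - 1) p).
  symmetry; apply: fsbig_widen => // m [_ /= mn]; rewrite /nordm.
  case: ltP => m0; last first.
    rewrite (_ : Smode s m p = 0) ?(field0 _ (fR s)) //.
    by case: m m0 {mn}.
  rewrite /Rmode (_ : n - m - 1 + 1 = Negz (absz (n - m + 1)%R)) ?(field0 _ fS) //.
  have : ~ (m <= n) by move=> h; apply: mn.
  by lia.
(* The exponent $i$ of the creation half corresponds to $m=-i-1$, and the remaining mode then forces
   the exponent $j=n-m$ of the other half. *)
rewrite (@reindex_fsbig _ _ _ _ _ (fun ij : nat * nat => Negz ij.1)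
  [set ij : nat * nat | ij.1%:Z - ij.2%:Z = - n - 1]).
  apply: eq_fsbigr => -[i j]; rewrite inE /= => ij.
  by rewrite /nordm /Rmode (_ : n - Negz i - 1 + 1 = Posz j) //; lia.
split.
- by move=> -[i j] /= ij; split; lia.
- move=> -[i j] [i' j']; rewrite !inE /= => ij ij' [ii']; rewrite ii'; congr (_, _).
  by lia.
- move=> m [m0 mn] /=; exists (absz (- m - 1)%R, absz (n - m)%R) => /=; lia.
Qed.

(** Only a positive mode of [Q] meets a creation operator, and only one of them; the factor $m$ of
    the double pole cancels the denominator in [cre]. *)
Lemma heis_S Q s w m n p : is_field Q -> heis Q delta w ->
  Q m (Smode s n p) = Smode s n (Q m p) + (if 0 < m then s * w else 0) *: Smode s (m + n) p.
Proof.
move=> fQ hQ; have lQ := field_lin m fQ; case: n => j.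
  rewrite /= (lin0 lQ) add0r; case: ltP => m0; last by rewrite scale0r.
  by case: m m0 {lQ} => // m; rewrite -PoszD scaler0.
case: m lQ => [[|r]|r] lQ /=; first 1 last.
- rewrite (expm_bracket (cre_lin s) (cre_comm s) (r := r) (w := s * w)) //; last first.
    move=> n q; rewrite /cre (linZ _ _ lQ) hQ scalerDr scalerA; congr (_ + _ *: _).
    rewrite (_ : (Posz r.+1 + Negz n == 0) = (n == r)); last by lia.
    case: eqP => [->|_]; last by rewrite mulr0.
    by rewrite -pmulrn mulrA divfK // pnatr_eq0.
  congr (_ + _ *: _); case: ltnP => h.
    by rewrite (_ : Posz r.+1 + Negz j = Negz (j - r.+1)) //; lia.
  by rewrite (_ : Posz r.+1 + Negz j = Posz (r - j)) //; lia.
- rewrite scale0r addr0; apply: expm_comm => // n q.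
  by rewrite /cre (linZ _ _ lQ) hQ scale0r addr0.
rewrite scale0r addr0; apply: expm_comm => // n q.
by rewrite /cre (linZ _ _ lQ) hQ scale0r addr0.
Qed.

Lemma heis_R Q s w m n p : is_field Q -> heis Q delta w ->
  Q m (Rmode s n p) = Rmode s n (Q m p) + (if m < 0 then s * w else 0) *: Rmode s (m + n) p.
Proof.
move=> fQ hQ; have lQ := field_lin m fQ; rewrite /Rmode -addrA; case: (n + 1) => j.
  case: m lQ => [[|r]|r] lQ /=; last first.
  - rewrite (expm_bracket (ann_lin s) (ann_comm s) (r := r) (w := s * w)) //; last first.
      move=> l q; rewrite /ann (linZ _ _ lQ) hQ scalerDr scalerA; congr (_ + _ *: _).
      rewrite (_ : (Negz r + Posz l.+1 == 0) = (l == r)); last by lia.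
      case: eqP => [->|_]; last by rewrite mulr0.
      by rewrite NegzE mulrNz -pmulrn mulrA mulrN divfK ?opprK // pnatr_eq0.
    congr (_ + _ *: _); case: ltnP => h.
      by rewrite (_ : Negz r + Posz j = Posz (j - r.+1)) //; lia.
    by rewrite (_ : Negz r + Posz j = Negz (r - j)) //; lia.
  - rewrite scale0r addr0; apply: expm_comm => // l q.
    by rewrite /ann (linZ _ _ lQ) hQ scale0r addr0.
  rewrite scale0r addr0; apply: expm_comm => // l q.
  by rewrite /ann (linZ _ _ lQ) hQ scale0r addr0.
rewrite (lin0 lQ) add0r; case: ltP => m0; last by rewrite scale0r.
case: m m0 {lQ} => // m _; rewrite (_ : Negz m + Negz j = Negz (m + j).+1) ?scaler0 //; lia.
Qed.

(** [dneg] and [dpos] split [delta] into the logarithmic derivatives, up to the factor [s], of the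
    two halves of the vertex operator. *)
Definition dneg n p := if n < 0 then delta n p else 0.
Definition dpos n p := if n < 0 then 0 else delta n p.

Lemma is_field_dneg : is_field dneg.
Proof.
split=> [n|p]; rewrite /dneg; last by exists 0 => n n0; rewrite ltNge n0.
by case: (n < 0); [exact: field_lin|exact: linear_0].
Qed.

Lemma is_field_dpos : is_field dpos.
Proof.
split=> [n|p]; rewrite /dpos.
  by case: (n < 0); [exact: linear_0|exact: field_lin].
by have [N HN] := fd.2 p; exists N => n /HN ->; rewrite if_same.
Qed.

Lemma comm_dneg X : is_field X -> comm delta X -> comm dneg X.
Proof. by move=> fX cX i j p; rewrite /dneg; case: ifP => _; rewrite ?cX ?(field0 _ fX). Qed.

Lemma comm_dpos X : is_field X -> comm delta X -> comm dpos X.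
Proof. by move=> fX cX i j p; rewrite /dpos; case: ifP => _; rewrite ?cX ?(field0 _ fX). Qed.

Lemma dmode_S s n p : dmode (Smode s) n p = s *: nprodm dneg (Smode s) n p.
Proof.
have fS := is_field_S s.
rewrite /dmode nprod_commE; last exact/comm_dneg/comm_delta_S.
have [n0|n0] := ltP 0 n.
  rewrite (_ : n - 1 = Posz (absz (n - 1)%R)); last by lia.
  rewrite scaler0 fsum0 ?scaler0 // => m; rewrite /dneg; case: ifP => m0 //.
  by rewrite (_ : n - m - 1 = Posz (absz (n - m - 1)%R)) ?(field0 _ fd) //; lia.
have [j ->] : exists j : nat, n = - j%:Z by exists `|n|%N; lia.
rewrite (_ : - j%:Z - 1 = Negz j); last by lia.
rewrite /= -mulrNz opprK -pmulrn expm_rec //.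
rewrite (@fsumE _ _ [seq Negz l | l <- iota 0 j]); first last.
- move=> i ij; rewrite /dneg; case: ifP => // i0.
  rewrite (_ : - j%:Z - i - 1 = Posz (absz (- j%:Z - i - 1)%R)) ?(field0 _ fd) //.
  suff : ~ (- j%:Z <= i) by lia.
  move=> h; case/negP: ij; apply/mapP; exists (absz (i + 1)%R); rewrite ?mem_iota; lia.
- by rewrite map_inj_uniq ?iota_uniq // => x y [].
rewrite big_map -[j in iota 0 j]subn0 big_mkord scaler_sumr.
apply: eq_bigr => l _; rewrite /cre /dneg /= scalerA mulrCA mulfV ?mulr1 ?pnatr_eq0 //.
by rewrite (_ : - j%:Z - Negz l - 1 = Negz (j - l.+1)) //; have := ltn_ord l; lia.
Qed.

Lemma dmode_R s n p : dmode (Rmode s) n p = s *: nprodm dpos (Rmode s) n p.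
Proof.
rewrite /dmode nprod_commE; last exact: comm_dpos (fR s) (@comm_delta_R s).
have [n0|n0] := ltP n 0.
  rewrite /Rmode subrK; case: n n0 => // j _; rewrite scaler0 fsum0 ?scaler0 // => m.
  rewrite /dpos; case: ifP => // m0; case: m m0 => // m _.
  rewrite (_ : Negz j - Posz m - 1 + 1 = Negz (j + m)) ?(field0 _ fd) //; lia.
case: n n0 => // j _.
rewrite /Rmode subrK /= scaleNr -pmulrn expm_rec //.
rewrite (@fsumE _ _ [seq Posz l.+1 | l <- iota 0 j]); first last.
- move=> i ij; rewrite /dpos; case: ifP => // i0.
  (* The exponent of [Rmode] contains no logarithm of $z$, so its derivative has no $z^{-1}$ term;
     this agrees with $\delta_{(0)}=0$. *)
  have [->|i1] := eqVneq i 0; first exact: d0.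
  rewrite (_ : Posz j - i - 1 + 1 = Negz (absz (i - Posz j - 1)%R)) ?(field0 _ fd) //.
  suff : ~ (i <= Posz j) by lia.
  move=> h; case/negP: ij; apply/mapP; exists (absz (i - 1)%R); rewrite ?mem_iota; lia.
- by rewrite map_inj_uniq ?iota_uniq // => x y [].
rewrite big_map -[j in iota 0 j]subn0 big_mkord scaler_sumr -sumrN.
apply: eq_bigr => l _; rewrite /ann /dpos /= scalerA mulrCA mulfV ?mulr1 ?pnatr_eq0 //.
rewrite scaleNr opprK; congr (_ *: delta _ _).
by rewrite (_ : Posz j - Posz l.+1 - 1 + 1 = Posz (j - l.+1)) //; have := ltn_ord l; lia.
Qed.

Let SR s := nprodm (Smode s) (Rmode s).

Let fS s : is_field (Smode s). Proof. exact: is_field_S. Qed.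
Let fSR s : is_field (SR s). Proof. exact: nprod_field. Qed.
Let fdn : is_field dneg. Proof. exact: is_field_dneg. Qed.
Let fdp : is_field dpos. Proof. exact: is_field_dpos. Qed.
Let cdS s : comm delta (Smode s). Proof. exact: comm_delta_S. Qed.
Let cdR s : comm delta (Rmode s). Proof. exact: comm_delta_R. Qed.
Let cSR s s' : comm (Smode s) (Rmode s'). Proof. exact: comm_S_R. Qed.
Let cRR s s' : comm (Rmode s) (Rmode s'). Proof. exact: comm_R_R. Qed.
Let cSS s s' : comm (Smode s) (Smode s'). Proof. exact: comm_S_S. Qed.

Lemma comm_X_SR X s : is_field X -> comm delta X -> comm X (SR s).
Proof.
move=> fX cX; have lX := field_lin _ fX.
apply: comm_nprod => // i j p.
  by apply: S_comm => // m q; rewrite cX.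
by apply: R_comm => // m q; rewrite cX.
Qed.

Lemma dmode_SR s n p : dmode (SR s) n p = s *: nprodm delta (SR s) n p.
Proof.
have fnS : is_field (nprodm dneg (Smode s)) by exact: nprod_field.
have fpR : is_field (nprodm dpos (Rmode s)) by exact: nprod_field.
rewrite -nprod_dmode //.
rewrite (eq_nprod (A := dmode (Smode s)) (A' := fun n q => s *: nprodm dneg (Smode s) n q)
  (B' := Rmode s)) //; last by move=> *; exact: dmode_S.
rewrite (eq_nprod (A' := Smode s) (B := dmode (Rmode s))
  (B' := fun n q => s *: nprodm dpos (Rmode s) n q)) //; last by move=> *; exact: dmode_R.
rewrite nprodZl // nprodZr // -scalerDr; congr (_ *: _).
have cnR : comm dneg (Rmode s) by exact: comm_dneg.
have cpR : comm dpos (Rmode s) by exact: comm_dpos.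
have cpS : comm dpos (Smode s) by exact: comm_dpos.
have cSpR : comm (Smode s) (nprodm dpos (Rmode s)).
  by apply: comm_nprod => //; exact: comm_sym.
rewrite (nprodA _ _ fdn (fS s) (fR s) cnR (@cSR s s)) (nprodC _ _ cSpR).
rewrite (nprodA _ _ fdp (fR s) (fS s) cpS (comm_sym (@cSR s s))).
rewrite (eq_nprod (A' := dpos) (B := nprodm (Rmode s) (Smode s)) (B' := SR s)) //; last first.
  by move=> m q; apply: nprodC; exact: comm_sym.
rewrite -(nprodDl _ _ fdn fdp (fSR s)); apply: (eq_nprod (B' := SR s)) => // m q.
by rewrite /dneg /dpos; case: ifP; rewrite ?addr0 ?add0r.
Qed.

Lemma nprod_S_S s n p : nprodm (Smode s) (Smode (- s)) n p = one_mode n p.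
Proof.
apply: (nprod_inverse (s := s) (fS s) (fS (- s)) fdn (@cSS s (- s))).
- exact: comm_dneg.
- exact: comm_dneg.
- by move=> *; exact: dmode_S.
- by move=> *; exact: dmode_S.
move=> q; rewrite nprod_commE // (@fsum1 _ _ (-1)) ?expm0 //= ?expm0 // => -[m|m] // m1.
rewrite (_ : -1 - Negz m - 1 = Posz m.-1) ?(field0 _ (fS s)) //.
by case: m m1 => // m _; lia.
Qed.

Lemma nprod_R_R s n p : nprodm (Rmode s) (Rmode (- s)) n p = one_mode n p.
Proof.
apply: (nprod_inverse (s := s) (fR s) (fR (- s)) fdp (@cRR s (- s))).
- exact: comm_dpos.
- exact: comm_dpos.
- by move=> *; exact: dmode_R.
- by move=> *; exact: dmode_R.
move=> q; rewrite nprod_commE // (@fsum1 _ _ (-1)).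
  by rewrite /Rmode /= !expm0.
move=> m m1; have [m0|m0] := ltP m (-1).
  by rewrite /Rmode (_ : m + 1 = Negz (absz (m + 2)%R)) //; lia.
have -> : Rmode (- s) (-1 - m - 1) q = 0.
  by rewrite /Rmode (_ : -1 - m - 1 + 1 = Negz (absz m)) //; move/eqP: m1; lia.
by rewrite (field0 _ (fR s)).
Qed.

(** All four halves commute because the modes of [delta] do, so $S_s$ can be paired with $S_{-s}$
    and $R_s$ with $R_{-s}$. *)
Lemma nprod_SR_SR s n p : nprodm (SR s) (SR (- s)) n p = one_mode n p.
Proof.
have cRS : comm (Rmode s) (Smode (- s)) by exact: comm_sym.
have cS_SR : comm (Smode s) (SR (- s)) by exact: comm_X_SR.
have cR_SR : comm (Rmode s) (SR (- s)) by exact: comm_X_SR.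
rewrite (nprodA _ _ (fS s) (fR s) (fSR (- s)) cS_SR cR_SR).
rewrite (eq_nprod (A' := Smode s) (B' := Smode (- s))) //.
  exact: nprod_S_S.
move=> m q.
rewrite -(nprodA _ _ (fR s) (fS (- s)) (fR (- s)) (@cRR s (- s)) (@cSR (- s) (- s))).
rewrite (eq_nprod (A' := nprodm (Smode (- s)) (Rmode s)) (B' := Rmode (- s))) //; last first.
  by move=> l u; exact: nprodC.
rewrite (nprodA _ _ (fS (- s)) (fR s) (fR (- s)) (@cSR _ _) (@cRR _ _)).
by apply: nprod_one => // l u; exact: nprod_R_R.
Qed.

Section One.
Variables (s : C) (q : V -> V).
Hypotheses (lq : linear q) (qd : forall m p, q (delta m p) = delta m (q p)).
Local Notation E := (Emode s q).

Lemma q_SR s' n p : q (SR s' n p) = SR s' n (q p).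
Proof.
apply: nprod_comm => // i u; first exact: S_comm.
exact: R_comm.
Qed.

Lemma is_field_E : is_field E.
Proof.
split=> [n|p]; first exact: (linear_comp lq (field_lin n (fSR s))).
by have [N HN] := (fSR s).2 p; exists N => n /HN; rewrite /SR /Emode => ->; rewrite (lin0 lq).
Qed.

Lemma comm_delta_E : comm delta E.
Proof. by move=> i j p; rewrite /Emode -qd comm_X_SR. Qed.

Lemma dmode_E n p : dmode E n p = s *: nprodm delta E n p.
Proof.
transitivity (q (dmode (SR s) n p)); first by rewrite /dmode (linZ _ _ lq).
rewrite dmode_SR (linZ _ _ lq); congr (_ *: _).
rewrite !nprod_commE; [|exact: comm_delta_E|exact: comm_X_SR].
rewrite (fsum_lin lq); last first.
  apply: eq_fin (nord_fin n p fd (fSR s)) => m; rewrite /nordm.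
  by rewrite -comm_X_SR // if_same.
by apply: eq_fsum => m; rewrite qd.
Qed.

(** Each mode $Q_m$ fails to commute with one factor at most: the creation half for $m>0$, the
    annihilation half for $m<0$, [q] for $m=0$. All three contribute the same weight $sw$. *)
Lemma vertex_E Q w : is_field Q -> heis Q delta w ->
  (forall m p, Q m (q p) = q (Q m p) + (if m == 0 then s * w else 0) *: q p) ->
  vertex Q E (s * w).
Proof.
move=> fQ hQ Qq m n p; rewrite /Emode Qq.
have fSm := is_fieldS m (fS s); have fRm := is_fieldS m (fR s).
rewrite (nprod_der (Q := Q m)
  (A' := fun l u => (if 0 < m then s * w else 0) *: Smode s (m + l) u)
  (B' := fun l u => (if m < 0 then s * w else 0) *: Rmode s (m + l) u)) //; first last.
- by move=> i u; apply: heis_R.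
- by move=> i u; apply: heis_S.
- exact: (is_fieldW (fun=> _) fRm).
- exact: (is_fieldW (fun=> _) fSm).
- exact: field_lin.
rewrite (nprodZl _ _ _ fSm (fR s)) (nprodZr _ _ _ (fS s) fRm).
rewrite nprod_shiftr nprod_shiftl // !(linD _ _ lq) !(linZ _ _ lq) (addrC m).
rewrite -!addrA; congr (_ + _); rewrite -/(SR s).
have -> : (if m == 0 then s * w else 0) *: q (SR s n p) =
  (if m == 0 then s * w else 0) *: q (SR s (n + m) p).
  by case: eqP => [->|_]; rewrite ?addr0 ?scale0r.
by case: (ltgtP m 0) => _; rewrite !scale0r ?addr0 ?add0r.
Qed.

Lemma comm_X_E X : is_field X -> comm delta X -> (forall m p, q (X m p) = X m (q p)) ->
  comm X E.
Proof. by move=> fX cX qX i j p; rewrite /Emode -qX comm_X_SR. Qed.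

End One.

Section Two.
Variables (s s' : C) (q q' : V -> V).
Hypotheses (lq : linear q) (qd : forall m p, q (delta m p) = delta m (q p)).
Hypotheses (lq' : linear q') (qd' : forall m p, q' (delta m p) = delta m (q' p)).
Hypothesis qq' : forall p, q (q' p) = q' (q p).

Lemma comm_E_E : comm (Emode s q) (Emode s' q').
Proof.
have fE := is_field_E s lq.
apply: comm_X_E => //; first exact: comm_delta_E.
move=> m p; rewrite /Emode -qq'; congr (q _).
by apply: nprod_comm => // i u; [exact: S_comm|exact: R_comm].
Qed.

Lemma nprod_E_E n p : s' = - s -> (forall p, q (q' p) = p) ->
  nprodm (Emode s q) (Emode s' q') n p = one_mode n p.
Proof.
move=> -> qK; rewrite -(nprod_SR_SR s); apply: eq_fsum => m; rewrite /nordm /Emode.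
case: ifP => _; first by rewrite -/(SR s) -(q_SR lq' qd') qK.
by rewrite -/(SR (- s)) -(q_SR lq qd) -qq' qK.
Qed.

End Two.

End VertexOperator.

(** * The Fock space *)

Section Linext.
Variables (C : numFieldType) (K : choiceType) (V : lmodType C).
Implicit Types (F : K -> V) (p q : {malg C[K]}).

Lemma linextEw F p (d : {fset K}) : (msupp p `<=` d)%fset ->
  linext F p = \sum_(m <- d) p@_m *: F m.
Proof.
move=> pd; apply: big_fset_incl => // m _ mp.
by rewrite mcoeff_outdom // scale0r.
Qed.

Lemma linext_linear F : linear (linext F).
Proof.
move=> a p q; pose d := (msupp p `|` msupp q)%fset.
have dp : (msupp p `<=` d)%fset by exact: fsubsetUl.
have dq : (msupp q `<=` d)%fset by exact: fsubsetUr.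
have dpq : (msupp (a *: p + q) `<=` d)%fset.
  apply: fsubset_trans (msuppD_le _ _) _.
  by apply: fsetUSS; [exact: msuppZ_le|exact: fsubset_refl].
rewrite (linextEw F dp) (linextEw F dq) (linextEw F dpq) scaler_sumr -big_split.
by apply: eq_bigr => m _ /=; rewrite mcoeffD mcoeffZ scalerDl scalerA.
Qed.

Lemma linext_param (U : lmodType C) (G : K -> U -> V) p : (forall m, linear (G m)) ->
  linear (fun u => linext (fun m => G m u) p).
Proof.
move=> lG a u v; rewrite /linext scaler_sumr -big_split.
by apply: eq_bigr => m _ /=; rewrite lG scalerDr !scalerA mulrC.
Qed.

Lemma malgUZ (a : C) (m : K) : << a *g m >> = a *: << m >> :> {malg C[K]}.
Proof.
by apply/malgP => m'; rewrite mcoeffZ !mcoeffU; case: eqP; rewrite ?mulr1n ?mulr1 // !mulr0n mulr0.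
Qed.

Lemma linextU F m : linext F << m >> = F m.
Proof.
by rewrite (linextEw F (d := [fset m]%fset)) ?msuppU_le // big_seq_fset1 mcoeffUU scale1r.
Qed.

Lemma malg_ind (P : {malg C[K]} -> Prop) :
  (forall a p q, P p -> P q -> P (a *: p + q)) -> P 0 -> (forall m, P << m >>) ->
  forall p, P p.
Proof.
move=> Plin P0 PU p; rewrite [p]monalgE.
elim/big_rec: _ => // m q _ Pq; rewrite malgUZ; exact: Plin.
Qed.

Lemma linear_ext (f g : {malg C[K]} -> V) : linear f -> linear g ->
  (forall m, f << m >> = g << m >>) -> forall p, f p = g p.
Proof.
move=> lf lg fg; apply: malg_ind => // [a p q fp fq|].
  by rewrite lf lg fp fq.
by rewrite (lin0 lf) (lin0 lg).
Qed.

End Linext.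

(* The Fock space is again kept abstract, as a module with a basis. *)
Section FockModule.
Variables (C : numFieldType) (V : lmodType C).
Variables (basis : {cmonom var} -> int -> V).
Variables (mulX dX : var -> V -> V) (mulQ : int -> V -> V) (eul : V -> V).
Implicit Types (p : V) (u v : var) (a : {cmonom var}) (j s : int).
Hypothesis basis_ind : forall P : V -> Prop,
  (forall x p q, P p -> P q -> P (x *: p + q)) -> (forall a j, P (basis a j)) ->
  forall p, P p.
Hypotheses (mulv_lin : forall v, linear (mulX v)) (dv_lin : forall v, linear (dX v))
  (mulq_lin : forall s, linear (mulQ s)) (eulerq_lin : linear eul).
Hypothesis mulvU : forall v a j, mulX v (basis a j) = basis (mmul (ucm v) a) j.
Hypothesis dvU : forall v a j, dX v (basis a j) = (a v)%:R *: basis (divcm a (ucm v)) j.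
Hypothesis mulqU : forall s a j, mulQ s (basis a j) = basis a (j + s).
Hypothesis eulerqU : forall a j, eul (basis a j) = j%:~R *: basis a j.

Lemma basis_ext (f g : V -> V) : linear f -> linear g ->
  (forall a j, f (basis a j) = g (basis a j)) -> forall p, f p = g p.
Proof.
by move=> lf lg fg; apply: basis_ind => // x p q fp fq; rewrite lf lg fp fq.
Qed.

Lemma mulv_mulv u v p : mulX u (mulX v p) = mulX v (mulX u p).
Proof.
apply: (basis_ext (linear_comp (mulv_lin u) (mulv_lin v))
  (linear_comp (mulv_lin v) (mulv_lin u))) => a j.
rewrite (mulvU v) (mulvU u) (mulvU u) (mulvU v); congr (basis _ _).
by apply/eqP/cmP => i; rewrite !cmM addnCA.
Qed.

Lemma dv_dv u v p : dX u (dX v p) = dX v (dX u p).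
Proof.
apply: (basis_ext (linear_comp (dv_lin u) (dv_lin v))
  (linear_comp (dv_lin v) (dv_lin u))) => a j.
rewrite (dvU v) (dvU u) (linZ _ _ (dv_lin u)) (linZ _ _ (dv_lin v)) (dvU u) (dvU v).
rewrite !scalerA !divcmE !cmU.
congr (_ *: basis _ _).
  have [->//|uv] := eqVneq u v.
  by rewrite !subn0 mulrC.
by apply/eqP/cmP => i; rewrite !divcmE subnAC.
Qed.

Lemma dv_mulv u v p : dX u (mulX v p) = mulX v (dX u p) + (u == v)%:R *: p.
Proof.
apply: (basis_ext (linear_comp (dv_lin u) (mulv_lin v)) (linear_add
  (linear_comp (mulv_lin v) (dv_lin u)) (linear_scale _ (@linear_id _ _)))) => a j.
rewrite (mulvU v) !(dvU u) (linZ _ _ (mulv_lin v)) (mulvU v) cmM cmU (eq_sym v).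
have [->|uv] := eqVneq u v; last first.
  rewrite scale0r addr0 add0n; congr (_ *: basis _ _).
  apply/eqP/cmP => i; rewrite !(divcmE, cmM, cmU).
  by have [<-|] := eqVneq u i; rewrite ?(eq_sym v) ?(negbTE uv) ?subn0 ?addn0.
have -> : divcm (mmul (ucm v) a) (ucm v) = a.
  by apply/eqP/cmP => i; rewrite divcmE cmM cmU addKn.
rewrite addnC natrD scalerDl; congr (_ + _).
have [->|mv] := eqVneq (a v) 0%N; first by rewrite !scale0r.
congr (_ *: basis _ _).
apply/eqP/cmP => i; rewrite !(divcmE, cmM, cmU).
by case: eqP => [<-|_]; rewrite ?subn0 //; lia.
Qed.

Lemma mulq_mulv s v p : mulQ s (mulX v p) = mulX v (mulQ s p).
Proof.
apply: (basis_ext (linear_comp (mulq_lin s) (mulv_lin v))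
  (linear_comp (mulv_lin v) (mulq_lin s))) => a j.
by rewrite (mulvU v) (mulqU s a) (mulvU v) (mulqU s).
Qed.

Lemma mulq_dv s v p : mulQ s (dX v p) = dX v (mulQ s p).
Proof.
apply: (basis_ext (linear_comp (mulq_lin s) (dv_lin v))
  (linear_comp (dv_lin v) (mulq_lin s))) => a j.
by rewrite (dvU v) (linZ _ _ (mulq_lin s)) (mulqU s a) (mulqU s) (dvU v).
Qed.

Lemma mulq_mulq s t p : mulQ s (mulQ t p) = mulQ (s + t) p.
Proof.
apply: (basis_ext (linear_comp (mulq_lin s) (mulq_lin t)) (mulq_lin (s + t))) => a j.
by rewrite (mulqU t) (mulqU s) (mulqU (s + t)) -addrA (addrC t).
Qed.

Lemma mulq0 p : mulQ 0 p = p.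
Proof.
apply: (basis_ext (mulq_lin 0) (@linear_id _ _)) => a j.
by rewrite mulqU addr0.
Qed.

Lemma eulerq_mulv v p : eul (mulX v p) = mulX v (eul p).
Proof.
apply: (basis_ext (linear_comp eulerq_lin (mulv_lin v))
  (linear_comp (mulv_lin v) eulerq_lin)) => a j.
by rewrite (eulerqU a) (linZ _ _ (mulv_lin v)) (mulvU v) (eulerqU (mmul _ _)).
Qed.

Lemma eulerq_dv v p : eul (dX v p) = dX v (eul p).
Proof.
apply: (basis_ext (linear_comp eulerq_lin (dv_lin v))
  (linear_comp (dv_lin v) eulerq_lin)) => a j.
by rewrite (eulerqU a) (linZ _ _ (dv_lin v)) (dvU v) (linZ _ _ eulerq_lin)
  (eulerqU (divcm _ _)) !scalerA mulrC.
Qed.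

Lemma eulerq_mulq s p : eul (mulQ s p) = mulQ s (eul p) + s%:~R *: mulQ s p.
Proof.
apply: (basis_ext (linear_comp eulerq_lin (mulq_lin s)) (linear_add
  (linear_comp (mulq_lin s) eulerq_lin) (linear_scale _ (mulq_lin s)))) => a j.
by rewrite (eulerqU a j) (linZ _ _ (mulq_lin s)) (mulqU s) (eulerqU a) -scalerDl -intrD.
Qed.

(** Induction on the degree of a monomial, splitting off one variable; it suits finiteness claims
    that survive multiplication by a variable. *)
Lemma basis_ind_mul (P : V -> Prop) :
  (forall x p q, P p -> P q -> P (x *: p + q)) ->
  (forall j, P (basis mone j)) -> (forall v p, P p -> P (mulX v p)) ->
  forall p, P p.
Proof.
move=> Plin P1 Pmul; apply: basis_ind => // m j.
move: {2}(mdeg m) (erefl (mdeg m)) => d; elim: d m => [|d IH] m dm.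
  by rewrite (mdeg_eq0I dm); exact: P1.
have [v mv] : exists v, m v != 0%N.
  apply: contrapT => h; suff m1 : m = mone by move: dm; rewrite m1 mdeg1.
  apply/eqP/cmP => i; rewrite cm1; apply/eqP/negPn/negP => mi; apply: h; by exists i.
have mE : m = mmul (ucm v) (divcm m (ucm v)).
  apply/eqP/cmP => i; rewrite cmM divcmE cmU; case: eqP => [<-|_]; last by rewrite subn0.
  lia.
have -> : basis m j = mulX v (basis (divcm m (ucm v)) j) by rewrite mulvU -mE.
by apply/Pmul/IH; move: dm; rewrite {1}mE mdegM mdegU; case.
Qed.

Lemma dv_one v j : dX v (basis mone j) = 0.
Proof. by rewrite dvU cm1 scale0r. Qed.

Definition bracket (f g : V -> V) (w : C) := forall p, f (g p) = g (f p) + w *: p.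

Lemma bracketD f f' g w w' : linear g -> bracket f g w -> bracket f' g w' ->
  bracket (fun p => f p + f' p) g (w + w').
Proof. by move=> lg h h' p; rewrite (linD _ _ lg) h h' scalerDl addrACA. Qed.

Lemma bracketZ f g x w : linear g -> bracket f g w ->
  bracket (fun p => x *: f p) g (x * w).
Proof. by move=> lg h p; rewrite (linZ _ _ lg) h scalerDr scalerA. Qed.

Lemma bracketC f g w : bracket f g w -> bracket g f (- w).
Proof. by move=> h p; rewrite h scaleNr addrK. Qed.

Definition comb (F : var -> V -> V) (x y t : C) (n : nat) p :=
  x *: F (X n) p + y *: F (Y n) p + t *: F (T n) p.

Lemma comb_lin F x y t n : (forall v, linear (F v)) -> linear (comb F x y t n).
Proof.
by move=> lF; apply: linear_add; first apply: linear_add; apply: linear_scale.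
Qed.

Lemma bracket_comb F g x y t n w1 w2 w3 : linear g ->
  bracket (F (X n)) g w1 -> bracket (F (Y n)) g w2 -> bracket (F (T n)) g w3 ->
  bracket (comb F x y t n) g (x * w1 + y * w2 + t * w3).
Proof.
by move=> lg h1 h2 h3; apply: bracketD => //; first apply: bracketD => //; apply: bracketZ.
Qed.

Lemma bracket_comb0 F g x y t n : linear g -> (forall v, bracket (F v) g 0) ->
  bracket (comb F x y t n) g 0.
Proof.
move=> lg h; have := bracket_comb x y t lg (h (X n)) (h (Y n)) (h (T n)).
by rewrite !mulr0 !addr0.
Qed.

Let dlin x y t n : linear (comb dX x y t n). Proof. exact: comb_lin. Qed.
Let mlin x y t n : linear (comb mulX x y t n). Proof. exact: comb_lin. Qed.

Lemma dcomb_dcomb x y t n x' y' t' m : bracket (comb dX x y t n) (comb dX x' y' t' m) 0.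
Proof.
apply: bracket_comb0 => // v; rewrite -oppr0; apply: bracketC.
apply: bracket_comb0 => // u p; by rewrite scale0r addr0 dv_dv.
Qed.

Lemma mcomb_mcomb x y t n x' y' t' m :
  bracket (comb mulX x y t n) (comb mulX x' y' t' m) 0.
Proof.
apply: bracket_comb0 => // v; rewrite -oppr0; apply: bracketC.
apply: bracket_comb0 => // u p; by rewrite scale0r addr0 mulv_mulv.
Qed.

Lemma dcomb_mcomb x y t n x' y' t' m :
  bracket (comb dX x y t n) (comb mulX x' y' t' m)
    (if n == m then x * x' + y * y' + t * t' else 0).
Proof.
have H u : bracket (comb mulX x' y' t' m) (dX u)
    (- (x' * (u == X m)%:R + y' * (u == Y m)%:R + t' * (u == T m)%:R)).
  rewrite !opprD -!mulrN; apply: bracket_comb => // p;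
  by rewrite dv_mulv scaleNr addrK.
have := bracket_comb x y t (mlin x' y' t' m) (bracketC (H (X n))) (bracketC (H (Y n)))
  (bracketC (H (T n))).
rewrite !opprK; have -> : (X n == X m) = (n == m) by [].
have -> : (Y n == Y m) = (n == m) by [].
have -> : (T n == T m) = (n == m) by [].
rewrite /= !mulr0 !addr0 !add0r.
by case: (n == m); rewrite ?mulr1 ?mulr0 ?addr0.
Qed.

(* The modes of $\alpha$, $\gamma$ and $\delta$ have this form: the a's are the
   coefficients of the derivations, the b's those of the multiplications by
   $x_n$, $y_n$, $t_n$, and z is the coefficient of $q\partial_q$. *)
Definition hop (a1 a2 a3 b1 b2 b3 z : C) (n : int) p :=
  match n with
  | Posz 0 => z *: eul p
  | Posz n.+1 => comb dX a1 a2 a3 n p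
  | Negz n => n.+1%:R *: comb mulX b1 b2 b3 n p
  end.

Let bracket0P (f g : V -> V) : (forall p, f (g p) = g (f p)) -> bracket f g 0.
Proof. by move=> fg p; rewrite fg scale0r addr0. Qed.

Let eul_d x y t n : bracket (comb dX x y t n) eul 0.
Proof. by apply: bracket_comb0 => // v; apply: bracket0P => p; rewrite eulerq_dv. Qed.

Let eul_m x y t n : bracket (comb mulX x y t n) eul 0.
Proof. by apply: bracket_comb0 => // v; apply: bracket0P => p; rewrite eulerq_mulv. Qed.

Lemma hop_lin (a1 a2 a3 b1 b2 b3 z : C) n : linear (hop a1 a2 a3 b1 b2 b3 z n).
Proof.
by case: n => [[|n]|n]; [exact: linear_scale|exact: dlin|exact/linear_scale/mlin].
Qed.

Lemma bracketZZ f g x y w : linear f -> linear g -> bracket f g w ->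
  bracket (fun p => x *: f p) (fun p => y *: g p) (x * (y * w)).
Proof.
move=> lf lg h; apply: bracketZ; first exact: linear_scale.
by rewrite -[y * w]opprK -mulrN; apply/bracketC/bracketZ/bracketC.
Qed.

(** For $i>0>j$ the derivations of the first field meet the variables of the second, and for $i<0<j$
    conversely. The two premises say that both pairings have the value [w]. *)
Lemma heis_hop (a1 a2 a3 b1 b2 b3 z a1' a2' a3' b1' b2' b3' z' w : C) :
  w = a1 * b1' + a2 * b2' + a3 * b3' -> w = a1' * b1 + a2' * b2 + a3' * b3 ->
  heis (hop a1 a2 a3 b1 b2 b3 z) (hop a1' a2' a3' b1' b2' b3' z') w.
Proof.
move=> w1 w2 i j; suff : bracket (hop a1 a2 a3 b1 b2 b3 z i) (hop a1' a2' a3' b1' b2' b3' z' j)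
  (if i + j == 0 then i%:~R * w else 0) by [].
(* Treats every sign pattern in which the operators commute: there $i+j\ne0$ or $i=0$, so the
   central scalar is 0 as well. *)
have w0 f g x : bracket f g x -> x = 0 -> i + j != 0 \/ i = 0 ->
    bracket f g (if i + j == 0 then i%:~R * w else 0).
  move=> h x0 ij; suff -> : (if i + j == 0 then i%:~R * w else 0) = x by [].
  by rewrite x0; case: ij => [/negbTE -> // |->]; rewrite mul0r if_same.
have ee : bracket eul eul 0 by apply: bracket0P.
case: i w0 => [[|i]|i] w0; case: j w0 => [[|j]|j] w0.
- apply: w0 (bracketZZ z z' eulerq_lin eulerq_lin ee) _ _; last by right.
  by rewrite !mulr0.
- apply: w0 (bracketZ z _ (bracketC (eul_d a1' a2' a3' j))) _ _ => //; last by right.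
  by rewrite oppr0 mulr0.
- apply: w0 (bracketZZ z j.+1%:R _ _ (bracketC (eul_m b1' b2' b3' j))) _ _ => //; last by right.
  by rewrite oppr0 !mulr0.
- apply: w0 (bracketC (bracketZ z' _ (bracketC (eul_d a1 a2 a3 i)))) _ _ => //; last by left; lia.
  by rewrite oppr0 mulr0 oppr0.
- by apply: w0 (dcomb_dcomb a1 a2 a3 i a1' a2' a3' j) _ _ => //; left; lia.
- have := bracketC (bracketZ j.+1%:R (dlin a1 a2 a3 i)
    (bracketC (dcomb_mcomb a1 a2 a3 i b1' b2' b3' j))).
  rewrite mulrN opprK -w1 (_ : (Posz i.+1 + Negz j == 0) = (i == j)); last by lia.
  by case: eqP => [->|_]; rewrite ?mulr0 -?pmulrn.
- apply: w0 (bracketZZ i.+1%:R z' _ _ (eul_m b1 b2 b3 i)) _ _ => //; last by left; lia.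
  by rewrite !mulr0.
- have := bracketZ i.+1%:R (dlin a1' a2' a3' j)
    (bracketC (dcomb_mcomb a1' a2' a3' j b1 b2 b3 i)).
  rewrite -w2 (_ : (Negz i + Posz j.+1 == 0) = (j == i)); last by lia.
  case: eqP => [->|_]; last by rewrite oppr0 mulr0.
  by rewrite mulrN -mulNr NegzE mulrNz -pmulrn.
- apply: w0 (bracketZZ i.+1%:R j.+1%:R _ _ (mcomb_mcomb b1 b2 b3 i b1' b2' b3' j)) _ _ => //.
    by rewrite !mulr0.
  by left; lia.
Qed.

Lemma eventually_dX p : exists N : nat, forall v n, v \in [:: X n; Y n; T n] -> (N <= n)%N ->
  dX v p = 0.
Proof.
move: p; apply: basis_ind_mul => [x p q [N HN] [N' HN']|j|u p [N HN]].
- exists (maxn N N') => v n vn; rewrite geq_max => /andP[h h'].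
  by rewrite (dv_lin v) (HN _ _ vn h) (HN' _ _ vn h') scaler0 addr0.
- by exists 0%N => v n _ _; exact: dv_one.
pose ix (w : var) := match w with inl (inl n) => n | inl (inr n) => n | inr n => n end.
exists (maxn N (ix u).+1) => v n vn; rewrite geq_max => /andP[h h'].
rewrite dv_mulv (HN _ _ vn h) (lin0 (mulv_lin u)) add0r.
have -> : (v == u) = false; last by rewrite scale0r.
apply/eqP => vu; move: vn h'; rewrite vu !inE => /or3P[] /eqP -> /=; by rewrite ltnn.
Qed.

Lemma is_field_hop (a1 a2 a3 b1 b2 b3 z : C) : is_field (hop a1 a2 a3 b1 b2 b3 z).
Proof.
split=> [n|p]; first exact: hop_lin.
have [N HN] := eventually_dX p; exists (Posz N.+1) => -[[|n]|n] //= nN.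
by rewrite /comb !(HN _ n) ?inE ?eqxx ?orbT ?scaler0 ?addr0.
Qed.

Lemma hop_mulQ (a1 a2 a3 b1 b2 b3 z : C) m s p :
  hop a1 a2 a3 b1 b2 b3 z m (mulQ s p) =
  mulQ s (hop a1 a2 a3 b1 b2 b3 z m p) + (if m == 0 then s%:~R * z else 0) *: mulQ s p.
Proof.
have lq := mulq_lin s.
case: m => [[|m]|m] /=; rewrite ?scale0r ?addr0.
- by rewrite eulerq_mulq (linZ _ _ lq) scalerDr scalerA mulrC.
- by rewrite /comb !(linD _ _ lq) !(linZ _ _ lq) !mulq_dv.
by rewrite (linZ _ _ lq) /comb !(linD _ _ lq) !(linZ _ _ lq) !mulq_mulv.
Qed.

Definition dhop := hop 1 (-1) 0 0 0 1 0.

Lemma dhop0 p : dhop 0 p = 0.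
Proof. exact: scale0r. Qed.

Lemma comm_dhop : comm dhop dhop.
Proof.
have h : heis dhop dhop 0 by apply: heis_hop; rewrite !(mulr0, mul0r, addr0).
by move=> i j p; rewrite h mulr0 if_same scale0r addr0.
Qed.

Lemma hop_vac (a1 a2 a3 b1 b2 b3 z : C) m : 0 <= m ->
  hop a1 a2 a3 b1 b2 b3 z m (basis mone 0) = 0.
Proof.
case: m => [[|m]|m] //= _; first by rewrite eulerqU scale0r scaler0.
by rewrite /comb !dv_one !scaler0 !addr0.
Qed.

Let alin (s : C) i : linear (ann dhop s i).
Proof. exact/linear_scale/hop_lin. Qed.

Let acomm (s : C) (i j : nat) p : ann dhop s i (ann dhop s j p) = ann dhop s j (ann dhop s i p).
Proof.
have fd : is_field dhop by exact: is_field_hop.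
by rewrite /ann !(fieldZ _ _ _ fd) comm_dhop !scalerA mulrC.
Qed.

Lemma expm_ann_one (s : C) (r : nat) j : (0 < r)%N -> expm (ann dhop s) r (basis mone j) = 0.
Proof.
case: r => // r _; have r0 : r.+1%:R != 0 :> C by rewrite pnatr_eq0.
apply: (scalerI r0); rewrite scaler0 expm_rec //; apply: big1 => n _.
rewrite (expm_comm (A := ann dhop s)) //.
suff -> : ann dhop s n (basis mone j) = 0.
  by rewrite (lin0 (expm_lin (alin s) _)) scaler0.
by rewrite /ann /dhop /= /comb !dv_one !scaler0 !addr0 scaler0.
Qed.

(** Multiplication by a variable has a scalar bracket with at most one nonzero value among the
    [ann], so by [expm_bracket] it raises the vanishing bound by at most the degree of that
    operator. *)
Lemma eventually_expm_ann (s : C) p :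
  exists N : nat, forall r, (N <= r)%N -> expm (ann dhop s) r p = 0.
Proof.
move: p; apply: basis_ind_mul => [x p q [N HN] [N' HN']|j|u p [N HN]].
- exists (maxn N N') => r; rewrite geq_max => /andP[h h'].
  by rewrite (expm_lin (alin s)) HN // HN' // scaler0 addr0.
- by exists 1%N => r; exact: expm_ann_one.
have [i [w H]] : exists (i : nat) (w : C), forall n q, mulX u (ann dhop s n q) =
    ann dhop s n (mulX u q) + (if n == i then w else 0) *: q.
  have Hcomb n q : mulX u (comb dX 1 (-1) 0 n q) = comb dX 1 (-1) 0 n (mulX u q) +
      ((Y n == u)%:R - (X n == u)%:R) *: q.
    have h : bracket (mulX u) (comb dX 1 (-1) 0 n)
        (- (1 * (X n == u)%:R + -1 * (Y n == u)%:R + 0 * (T n == u)%:R)).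
      by apply/bracketC/bracket_comb => // q'; rewrite dv_mulv.
    by rewrite h mul1r mulN1r mul0r addr0 opprB.
  have Hann n q : mulX u (ann dhop s n q) = ann dhop s n (mulX u q) +
      (- s / n.+1%:R * ((Y n == u)%:R - (X n == u)%:R)) *: q.
    by rewrite /ann (linZ _ _ (mulv_lin u)) /= Hcomb scalerDr scalerA.
  case: u {HN Hcomb} Hann => [[m|m]|m] Hann; exists m.
  - exists (- s / m.+1%:R * -1) => n q; rewrite Hann; congr (_ + _ *: _).
    rewrite (_ : (X n == inl (inl m)) = (n == m)) //= sub0r.
    by case: eqP => [->|_]; rewrite ?oppr0 ?mulr0.
  - exists (- s / m.+1%:R) => n q; rewrite Hann; congr (_ + _ *: _).
    rewrite (_ : (Y n == inl (inr m)) = (n == m)) //= subr0.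
    by case: eqP => [->|_]; rewrite ?mulr1 ?mulr0.
  (* $t$-variables commute with all annihilation operators, so the scalar is 0 and the index [m] is
     an arbitrary choice. *)
  - by exists 0 => n q; rewrite Hann /= subrr mulr0 if_same.
exists (N + i.+1)%N => r hr.
have := expm_bracket (alin s) (acomm s) r p (mulv_lin u) H.
rewrite HN ?(lin0 (mulv_lin u)); last by lia.
rewrite HN; last by lia.
by rewrite if_same scaler0 addr0 => <-.
Qed.

Lemma is_field_Rmode (s : C) : is_field (Rmode dhop s).
Proof.
split=> [n|p]; rewrite /Rmode.
  by case: (n + 1) => j; [exact: expm_lin|exact: linear_0].
have [N HN] := eventually_expm_ann s p; exists (Posz N) => n Nn.
by rewrite (_ : n + 1 = Posz (absz (n + 1)%R)) ?HN //; lia.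
Qed.

Lemma dhopE n p : dhop n p = match n with
  | Posz 0 => 0
  | Posz n.+1 => dX (X n) p - dX (Y n) p
  | Negz n => n.+1%:R *: mulX (T n) p
  end.
Proof.
case: n => [[|n]|n]; rewrite /dhop /hop /comb ?scale0r ?scaleN1r ?scale1r ?addr0 //.
by rewrite add0r.
Qed.

Lemma cre_dhop (s : C) i p : cre dhop s i p = s *: mulX (T i) p.
Proof. by rewrite /cre dhopE scalerA divfK // pnatr_eq0. Qed.

Lemma ann_dhop (s : C) i p :
  ann dhop s i p = (s / i.+1%:R) *: (dX (Y i) p - dX (X i) p).
Proof. by rewrite /ann dhopE mulNr scaleNr -scalerN opprB. Qed.

Lemma Emode_vac (s : C) (q : V -> V) n : linear q -> 0 <= n ->
  Emode dhop s q n (basis mone 0) = 0.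
Proof.
move=> lq n0; rewrite /Emode (_ : nprodm _ _ _ _ = 0) ?(lin0 lq) //.
apply: fsum0 => m; rewrite /nordm; case: ifP => m0.
  rewrite /Rmode (_ : n - m - 1 + 1 = Posz (absz (n - m)%R)); last by lia.
  rewrite expm_ann_one; last by lia.
  apply: lin0; apply: field_lin; apply: is_field_S; exact: is_field_hop.
rewrite (_ : Smode _ _ m _ = 0); last by case: m m0.
by apply/lin0/field_lin/is_field_Rmode.
Qed.

(** * The fields of level $k$ on the Fock space *)

Section Level.
Variable k : C.
Let c : C := k + 1.
(** Coefficients of $x_n$ and $y_n$ in $\gamma_{(-n)}/n$: $y_n$ in general, $-x_n$ for $k=-2$. Since
    $c=-1$ in the latter case, all pairings keep their values. *)
Let g1 : C := if k == -2 then -1 else 0.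
Let g2 : C := if k == -2 then 0 else 1.

Definition ahop := hop 1 c 1 1 0 0 1.
Definition ghop := hop c 1 (-1) g1 g2 0 (-1).
Definition Ehop (s : int) := Emode dhop s%:~R (mulQ s).
Definition ehop := em ahop (Ehop 1).
Definition fhop := fm ghop (Ehop (-1)).
Definition hhop := hm k ahop ghop dhop.
Definition Dhop := Dm k ahop ghop dhop.

Let fa : is_field ahop. Proof. exact: is_field_hop. Qed.
Let fg : is_field ghop. Proof. exact: is_field_hop. Qed.
Let fd : is_field dhop. Proof. exact: is_field_hop. Qed.
Let fR (s : C) : is_field (Rmode dhop s). Proof. exact: is_field_Rmode. Qed.

Let qd s m p : mulQ s (dhop m p) = dhop m (mulQ s p).
Proof. by rewrite /dhop hop_mulQ mulr0 if_same scale0r addr0. Qed.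

Let fE s : is_field (Ehop s). Proof. exact: is_field_E. Qed.

Let level2 : k == -2 -> c = -1.
Proof. by move=> /eqP k2; rewrite /c k2; ring. Qed.

Let haa : heis ahop ahop 1. Proof. by apply: heis_hop; ring. Qed.
Let hag : heis ahop ghop c.
Proof.
apply: heis_hop; last by ring.
by rewrite /g1 /g2; case: ifP => [/level2 ->|_]; ring.
Qed.
Let hgg : heis ghop ghop 1.
Proof. by apply: heis_hop; rewrite /g1 /g2; case: ifP => [/level2 ->|_]; ring. Qed.
Let hda : heis dhop ahop 1. Proof. by apply: heis_hop; ring. Qed.
Let hdg : heis dhop ghop (-1).
Proof. by apply: heis_hop; rewrite /g1 /g2; case: (k == -2); ring. Qed.
Let hdd : heis dhop dhop 0. Proof. by apply: heis_hop; ring. Qed.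

Let vertex_hop (a1 a2 a3 b1 b2 b3 z : C) s :
  heis dhop (hop a1 a2 a3 b1 b2 b3 z) z ->
  vertex (hop a1 a2 a3 b1 b2 b3 z) (Ehop s) (s%:~R * z).
Proof.
move=> hd; apply: vertex_E => //.
- exact: comm_dhop.
- exact: is_field_hop.
- exact: heis_sym.
by move=> m p; rewrite hop_mulQ.
Qed.

Let vaE : vertex ahop (Ehop 1) 1.
Proof. by have := vertex_hop (1) hda; rewrite mulr1. Qed.
Let vaF : vertex ahop (Ehop (-1)) (-1).
Proof. by have := vertex_hop (-1) hda; rewrite mulr1. Qed.
Let vgE : vertex ghop (Ehop 1) (-1).
Proof. by have := vertex_hop (1) hdg; rewrite mul1r. Qed.
Let vgF : vertex ghop (Ehop (-1)) 1.
Proof. by have := vertex_hop (-1) hdg; rewrite mulrNN mulr1. Qed.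
Let vdE s : vertex dhop (Ehop s) 0.
Proof. by have := vertex_hop (s) hdd; rewrite mulr0. Qed.

Let cE s s' : comm (Ehop s) (Ehop s').
Proof. by apply: comm_E_E => // p; [exact: comm_dhop|rewrite !mulq_mulq addrC]. Qed.

Let FE1 n p : nprodm (Ehop (-1)) (Ehop 1) n p = one_mode n p.
Proof.
apply: nprod_E_E => //.
- exact: comm_dhop.
- exact: dhop0.
- by move=> q; rewrite !mulq_mulq addrC.
- by rewrite opprK.
- by move=> q; rewrite mulq_mulq addNr mulq0.
Qed.

Let dE n p : dmode (Ehop 1) n p = nprodm dhop (Ehop 1) n p.
Proof. by rewrite dmode_E ?scale1r //; [exact: comm_dhop|exact: dhop0]. Qed.

Let dF n p : dmode (Ehop (-1)) n p = - nprodm dhop (Ehop (-1)) n p.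
Proof. by rewrite dmode_E ?scaleN1r //; [exact: comm_dhop|exact: dhop0]. Qed.

Let apg0 : c = -1 -> forall n p, ahop n p + ghop n p = 0.
Proof.
move=> c1 n p; have k2 : k == -2.
  by rewrite -subr_eq0 opprK; apply/eqP; rewrite -[k](addrK 1) -/c c1; ring.
rewrite /ahop /ghop /g1 /g2 k2 c1; case: n => [[|n]|n] /=.
- by rewrite -scalerDl subrr scale0r.
- rewrite /comb addrACA -scalerDl subrr scale0r addr0.
  by rewrite addrACA -!scalerDl subrr addNr !scale0r addr0.
- by rewrite -scalerDr /comb !scale0r !addr0 -scalerDl subrr scale0r scaler0.
Qed.

Lemma ahopE n p : ahop n p = match n with
  | Posz 0 => eul p
  | Posz n.+1 => dX (X n) p + c *: dX (Y n) p + dX (T n) p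
  | Negz n => n.+1%:R *: mulX (X n) p
  end.
Proof.
by case: n => [[|n]|n]; rewrite /ahop /hop /comb ?scale0r ?scale1r ?addr0.
Qed.

Lemma ghopE n p : ghop n p = match n with
  | Posz 0 => - eul p
  | Posz n.+1 => c *: dX (X n) p + dX (Y n) p - dX (T n) p
  | Negz n => n.+1%:R *: (if k == -2 then - mulX (X n) p else mulX (Y n) p)
  end.
Proof.
case: n => [[|n]|n]; rewrite /ghop /hop /comb ?scaleN1r ?scale1r // /g1 /g2.
by case: ifP; rewrite !scale0r ?scaleN1r ?scale1r ?addr0 ?add0r.
Qed.

Lemma is_field_ehop : is_field ehop. Proof. exact: nprod_field. Qed.
Lemma is_field_fhop : is_field fhop. Proof. exact: nprod_field. Qed.
Lemma is_field_hhop : is_field hhop. Proof. exact: is_field_hm. Qed.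
Lemma Dhop_linear : linear Dhop. Proof. exact: Dm_linear. Qed.

Section Casimir.
Variables (W : lmodType C) (tensor : V -> V -> W).
Hypotheses (tl : forall r, linear (tensor ^~ r)) (tr : forall p, linear (tensor p)).
Local Notation Om := (casimir tensor k ehop fhop hhop Dhop).

Let te : transl Dhop ehop. Proof. exact: transl_em. Qed.
Let tf : transl Dhop fhop. Proof. exact: transl_fm. Qed.
Let th : transl Dhop hhop. Proof. exact: transl_hm. Qed.
Let ef m n p : ehop m (fhop n p) = fhop n (ehop m p) + hhop (m + n) p
  + (if m + n == 0 then m%:~R * k else 0) *: p.
Proof. exact: em_fm. Qed.

Lemma casimir_ehop n P p r : linear P ->
  (forall p r, P (tensor p r) = tensor (ehop n p) r + tensor p (ehop n r)) ->
  P (Om p r) = Om (ehop n p) r + Om p (ehop n r).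
Proof.
move=> lP He; apply: casimir_e => //.
- exact: is_field_ehop.
- exact: is_field_fhop.
- exact: is_field_hhop.
- exact: em_comm.
- by move=> l m q; exact: hm_em.
Qed.

Lemma casimir_fhop n P p r : linear P ->
  (forall p r, P (tensor p r) = tensor (fhop n p) r + tensor p (fhop n r)) ->
  P (Om p r) = Om (fhop n p) r + Om p (fhop n r).
Proof.
move=> lP He; apply: casimir_f => //.
- exact: is_field_ehop.
- exact: is_field_fhop.
- exact: is_field_hhop.
- exact: fm_comm.
- by move=> l m q; exact: hm_fm.
Qed.

Lemma casimir_hhop n P p r : linear P ->
  (forall p r, P (tensor p r) = tensor (hhop n p) r + tensor p (hhop n r)) ->
  P (Om p r) = Om (hhop n p) r + Om p (hhop n r).
Proof.
move=> lP He; apply: casimir_h => //.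
- exact: is_field_ehop.
- exact: is_field_fhop.
- exact: is_field_hhop.
- by move=> l m q; exact: hm_em.
- by move=> l m q; exact: hm_fm.
- exact: hm_hm.
Qed.

(** Of the indices $m$ and $-m-1$ one is always nonnegative, and nonnegative modes of all the fields
    kill the constant 1. The same parity of indices in the quadratic terms gives $L_{-1}1=0$. *)
Lemma casimir_vac : Om (basis mone 0) (basis mone 0) = 0.
Proof.
set v := basis mone 0.
have np A B n : is_field A -> is_field B ->
    (forall m, 0 <= m -> A m v = 0) -> (forall m, 0 <= m -> B m v = 0) ->
    0 <= n -> nprodm A B n v = 0.
  move=> fA fB A0 B0 n0; apply: fsum0 => m; rewrite /nordm; case: ltP => m0.
    by rewrite B0 ?(field0 _ fA) //; lia.
  by rewrite A0 ?(field0 _ fB).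
have a0 m : 0 <= m -> ahop m v = 0 by exact: hop_vac.
have g0 m : 0 <= m -> ghop m v = 0 by exact: hop_vac.
have d0 m : 0 <= m -> dhop m v = 0 by exact: hop_vac.
have E0 s m : 0 <= m -> Ehop s m v = 0 by exact: Emode_vac.
have e0 m : 0 <= m -> ehop m v = 0 by move=> m0; apply: np => // i; exact: E0.
have f0 m : 0 <= m -> fhop m v = 0 by move=> m0; apply: np => // i; exact: E0.
have h0 m : 0 <= m -> hhop m v = 0.
  by move=> m0; rewrite /hhop /hm a0 // g0 // d0 // scaler0 subr0 addr0.
have amf : is_field (amgm ahop ghop) by exact: is_fieldB.
have apf : is_field (apgm ahop ghop) by exact: is_fieldD.
have am0 m : 0 <= m -> amgm ahop ghop m v = 0.
  by move=> m0; rewrite /amgm a0 // g0 // subr0.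
have ap0 m : 0 <= m -> apgm ahop ghop m v = 0.
  by move=> m0; rewrite /apgm a0 // g0 // addr0.
have D0 : Dhop v = 0.
  rewrite /Dhop /Dm (np _ _ 0 fd fd) // (np _ _ 0 fd amf) // (np _ _ 0 apf apf) //.
  by rewrite !scaler0 if_same !addr0.
have tp A B : (forall m, 0 <= m -> A m v = 0) -> (forall m, 0 <= m -> B m v = 0) ->
    tprod tensor A B v v = 0.
  move=> A0 B0; apply: fsum0 => m; have [m0|m0] := ltP m 0.
    by rewrite B0 ?(lin0 (tr _)) //; lia.
  by rewrite A0 ?(lin0 (tl _)).
by rewrite /casimir !tp // D0 (lin0 (tr _)) (lin0 (tl _)) !scaler0 !addr0 !subr0.
Qed.

End Casimir.
End Level.
End FockModule.

(** * Identification with the operators on Laurent polynomials *)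

Section Concrete.
Variable C : numFieldType.
Local Notation V := (Fock C).
Implicit Types (p r : V) (v : var) (m n s j : int).

Lemma mulv_linear v : linear (@mulv C v). Proof. exact: linext_linear. Qed.
Lemma dv_linear v : linear (@dv C v). Proof. exact: linext_linear. Qed.
Lemma mulq_linear s : linear (@mulq C s). Proof. exact: linext_linear. Qed.
Lemma eulerq_linear : linear (@eulerq C). Proof. exact: linext_linear. Qed.

Definition basis (a : {cmonom var}) (j : int) : V := << (a, j) >>.

Lemma Fock_ind (P : V -> Prop) :
  (forall x p q, P p -> P q -> P (x *: p + q)) -> (forall a j, P (basis a j)) ->
  forall p, P p.
Proof.
move=> Plin PU; apply: malg_ind => // [|[a j]]; last exact: PU.
by have := Plin (-1) _ _ (PU mone 0) (PU mone 0); rewrite scaleN1r addNr.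
Qed.

Lemma mulv_basis v a j : mulv v (basis a j) = basis (mmul (ucm v) a) j.
Proof. exact: linextU. Qed.

Lemma dv_basis v a j : dv v (basis a j) = (a v)%:R *: basis (divcm a (ucm v)) j.
Proof. by rewrite -malgUZ; exact: linextU. Qed.

Lemma mulq_basis s a j : mulq s (basis a j) = basis a (j + s).
Proof. exact: linextU. Qed.

Lemma eulerq_basis a j : eulerq (basis a j) = j%:~R *: basis a j.
Proof. by rewrite -malgUZ; exact: linextU. Qed.

Local Notation Chop := (hop (@mulv C) (@dv C) (@eulerq C)).
Local Notation Cdhop := (dhop (@mulv C) (@dv C) (@eulerq C)).
Local Notation CEhop := (Ehop (@mulv C) (@dv C) (@mulq C) (@eulerq C)).

Lemma alphaE k : alpha k = ahop (@mulv C) (@dv C) (@eulerq C) k.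
Proof. by apply/funext => n; apply/funext => p; rewrite ahopE. Qed.

Lemma gammaE k : gamma k = ghop (@mulv C) (@dv C) (@eulerq C) k.
Proof. by apply/funext => n; apply/funext => p; rewrite ghopE. Qed.

Lemma deltaE : @delta C = Cdhop.
Proof. by apply/funext => n; apply/funext => p; rewrite dhopE. Qed.

Lemma cre_delta (s : int) :
  (fun i u => s%:~R *: mulv (T i) u : V) = cre Cdhop s%:~R.
Proof. by apply/funext => i; apply/funext => u; rewrite cre_dhop. Qed.

Lemma ann_delta (s : int) :
  (fun i u => (s%:~R / i.+1%:R) *: (dv (Y i) u - dv (X i) u) : V) =
  ann Cdhop s%:~R.
Proof. by apply/funext => i; apply/funext => u; rewrite ann_dhop. Qed.

Lemma is_field_Cdhop : is_field Cdhop.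
Proof.
exact: (is_field_hop Fock_ind mulv_linear dv_linear eulerq_linear mulv_basis dv_basis).
Qed.

Lemma is_field_CRmode (s : C) : is_field (Rmode Cdhop s).
Proof.
exact: (is_field_Rmode Fock_ind mulv_linear dv_linear eulerq_linear mulv_basis
  dv_basis eulerq_basis).
Qed.

Lemma edeltaE (s : int) : @edelta C s = CEhop s.
Proof.
apply/funext => n; apply/funext => p.
rewrite /Ehop (EmodeE is_field_Cdhop is_field_CRmode) -cre_delta -ann_delta.
reflexivity.
Qed.

Lemma e_E k : e_ k = ehop (@mulv C) (@dv C) (@mulq C) (@eulerq C) k.
Proof. by rewrite /e_ alphaE edeltaE. Qed.

Lemma f_E k : f_ k = fhop (@mulv C) (@dv C) (@mulq C) (@eulerq C) k.
Proof. by rewrite /f_ gammaE edeltaE. Qed.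

Lemma h_E k : h_ k = hhop (@mulv C) (@dv C) (@eulerq C) k.
Proof. by rewrite /h_ alphaE gammaE deltaE. Qed.

(** [quad] pairs indices of sum [n], [nprodm] those of sum $n-1$; hence the shift from $-1$ to 0. *)
Lemma quadE (A B : int -> V -> V) p : quad A B (0 - 1) p = nprodm A B 0 p.
Proof.
apply: eq_fsum => m; rewrite -[RHS]/(nord A B m (0 - m - 1) p).
by congr (nord A B m _ p); lia.
Qed.

Lemma L_E k : L_ k (0 - 1) = Dhop (@mulv C) (@dv C) (@eulerq C) k.
Proof.
apply/funext => p; rewrite /L_ !quadE /amg /apg alphaE gammaE deltaE.
reflexivity.
Qed.

End Concrete.

(** * The tensor square *)

Section Tensor.
Variable C : numFieldType.
Local Notation V := (Fock C).
Local Notation W := (Fock2 C).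
Implicit Types (p r : V) (w : W) (n : int) (A B : int -> V -> V).

Lemma tens_linl r : linear (fun p => tens p r).
Proof. exact: linext_linear. Qed.

Lemma tens_linr p : linear (tens p).
Proof.
exact: (linext_param (G := fun m => linext (fun m' => << (m, m') >> : W)) p
  (fun m => linext_linear _)).
Qed.

Lemma tens_U m m' : tens << m >> << m' >> = << (m, m') >> :> W.
Proof. by rewrite /tens !linextU. Qed.

Lemma Fock2_ind (P : W -> Prop) : (forall a u v, P u -> P v -> P (a *: u + v)) ->
  (forall p r, P (tens p r)) -> forall w, P w.
Proof.
move=> Plin Pt; apply: malg_ind => // [|[m m']]; last by rewrite -tens_U.
by have := Pt 0 0; rewrite (lin0 (tens_linr 0)).
Qed.

Lemma tens_ext (f g : W -> W) : linear f -> linear g ->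
  (forall p r, f (tens p r) = g (tens p r)) -> forall w, f w = g w.
Proof.
by move=> lf lg fg; apply: Fock2_ind => // a u v fu fv; rewrite lf lg fu fv.
Qed.

Lemma tensop_lin (F G : V -> V) : linear (tensop F G).
Proof. exact: linext_linear. Qed.

(** [tensop] only consults [F] and [G] on basis monomials; their linearity carries the formula to
    all pure tensors. *)
Lemma tensop_tens (F G : V -> V) p r : linear F -> linear G ->
  tensop F G (tens p r) = tens (F p) (G r).
Proof.
move=> lF lG; move: p; apply: linear_ext => [||m].
- by move=> a u v; rewrite tens_linl tensop_lin.
- by move=> a u v; rewrite lF tens_linl.
move: r; apply: linear_ext => [||m'].
- by move=> a u v; rewrite tens_linr tensop_lin.
- by move=> a u v; rewrite lG tens_linr.
by rewrite tens_U /tensop linextU.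
Qed.

Lemma diag_lin (F : V -> V) : linear (diag F).
Proof. exact: (linear_add (tensop_lin _ _) (tensop_lin _ _)). Qed.

Lemma diag_tens (F : V -> V) p r : linear F ->
  diag F (tens p r) = tens (F p) r + tens p (F r).
Proof. by move=> lF; rewrite /diag !tensop_tens. Qed.

Lemma tensop_tprod A B p r m : is_field A -> is_field B ->
  tensop (A m) (B (0 - m - 1)) (tens p r) = tens (A m p) (B (- m - 1) r).
Proof.
move=> fA fB; rewrite tensop_tens; [|exact: field_lin..].
by rewrite sub0r.
Qed.

Lemma tensmode_tens A B p r : is_field A -> is_field B ->
  tensmode A B 0 (tens p r) = tprod (@tens C) A B p r.
Proof. by move=> fA fB; apply: eq_fsum => m; exact: tensop_tprod. Qed.

(** Truncation of both fields bounds the sum on a pure tensor, and every element is a finite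
    combination of pure tensors. *)
Lemma tensmode_fin A B w : is_field A -> is_field B ->
  fin (fun m => tensop (A m) (B (0 - m - 1)) w).
Proof.
move=> fA fB; move: w; apply: Fock2_ind => [a u v fu fv|p r].
  by apply: eq_fin (finD (finZ a fu) fv) => m; rewrite tensop_lin.
apply: eq_fin (tprod_fin tens_linl tens_linr p r fA fB) => m.
by rewrite tensop_tprod.
Qed.

Lemma tensmode_lin A B : is_field A -> is_field B -> linear (tensmode A B 0).
Proof.
move=> fA fB a u v; rewrite /tensmode.
rewrite -fsumZ; last exact: tensmode_fin.
rewrite -fsumD; [|exact/finZ/tensmode_fin|exact: tensmode_fin].
by apply: eq_fsum => m; rewrite tensop_lin.
Qed.

Variable k : C.

Lemma is_field_e : is_field (e_ k).
Proof.
rewrite e_E.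
exact: (is_field_ehop (@Fock_ind C) (@mulv_linear C) (@dv_linear C) (@mulq_linear C)
  (@eulerq_linear C) (@mulv_basis C) (@dv_basis C) (@eulerq_basis C)).
Qed.

Lemma is_field_f : is_field (f_ k).
Proof.
rewrite f_E.
exact: (is_field_fhop (@Fock_ind C) (@mulv_linear C) (@dv_linear C) (@mulq_linear C)
  (@eulerq_linear C) (@mulv_basis C) (@dv_basis C) (@eulerq_basis C)).
Qed.

Lemma is_field_h : is_field (h_ k).
Proof.
rewrite h_E.
exact: (is_field_hhop (@Fock_ind C) (@mulv_linear C) (@dv_linear C)
  (@eulerq_linear C) (@mulv_basis C) (@dv_basis C)).
Qed.

Lemma L_lin : linear (L_ k (0 - 1)).
Proof.
rewrite L_E.
exact: (Dhop_linear (@Fock_ind C) (@mulv_linear C) (@dv_linear C)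
  (@eulerq_linear C) (@mulv_basis C) (@dv_basis C)).
Qed.

Let fe := is_field_e.
Let ff := is_field_f.
Let fh := is_field_h.

Lemma Omega_lin : linear (Omega k 0).
Proof.
have sub (f g : W -> W) : linear f -> linear g -> linear (fun w => f w - g w).
  move=> lf lg a u v; rewrite lf lg scalerBr.
  by rewrite opprD addrACA.
apply: (sub _ _ _ (tensop_lin _ _)); apply: (sub _ _ _ (tensop_lin _ _)).
apply: linear_add; first exact: (linear_add (tensmode_lin fe ff) (tensmode_lin ff fe)).
exact: (linear_scale (1 / 2) (tensmode_lin fh fh)).
Qed.

Lemma Omega_tens p r :
  Omega k 0 (tens p r) = casimir (@tens C) k (e_ k) (f_ k) (h_ k) (L_ k (0 - 1)) p r.
Proof.
have lk : linear (fun q : V => k *: q) by exact: scale_lin.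
have tk : tens (L_ k (0 - 1) p) (k *: r) = k *: tens (L_ k (0 - 1) p) r.
  exact: (linZ _ _ (tens_linr _)).
have kt : tens (k *: p) (L_ k (0 - 1) r) = k *: tens p (L_ k (0 - 1) r).
  exact: (linZ _ _ (tens_linl _)).
have congr5 (x : C) (a a' b b' c c' d d' f f' : W) : a = a' -> b = b' -> c = c' ->
    d = d' -> f = f' -> a + b + x *: c - d - f = a' + b' + x *: c' - d' - f'.
  by move=> -> -> -> -> ->.
rewrite /Omega /casimir.
exact: (congr5 _ _ _ _ _ _ _ _ _ _ _
  (tensmode_tens p r fe ff) (tensmode_tens p r ff fe) (tensmode_tens p r fh fh)
  (etrans (tensop_tens p r lk L_lin) kt) (etrans (tensop_tens p r L_lin lk) tk)).
Qed.

Local Notation cas := (casimir (@tens C) k (e_ k) (f_ k) (h_ k) (L_ k (0 - 1))).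

(** Both sides are linear in [w], so pure tensors suffice, and there [Omega] becomes the bilinear
    expression [casimir]. *)
Lemma Omega_comm (F : V -> V) : linear F ->
  (forall p r, diag F (cas p r) = cas (F p) r + cas p (F r)) ->
  forall w, Omega k 0 (diag F w) = diag F (Omega k 0 w).
Proof.
move=> lF HF; apply: tens_ext => [||p r].
- exact: (linear_comp Omega_lin (diag_lin _)).
- exact: (linear_comp (diag_lin _) Omega_lin).
apply: (etrans (congr1 (Omega k 0) (diag_tens p r lF))).
apply: (etrans (linD _ _ Omega_lin)).
apply: (etrans (congr2 +%R (Omega_tens (F p) r) (Omega_tens p (F r)))).
exact: (etrans (esym (HF p r)) (congr1 (diag F) (esym (Omega_tens p r)))).
Qed.

Lemma Omega_e n w : Omega k 0 (diag (e_ k n) w) = diag (e_ k n) (Omega k 0 w).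
Proof.
have lx := field_lin n fe; apply: (Omega_comm lx) => p r.
have dt p' r' := diag_tens p' r' lx; move: dt; rewrite e_E f_E h_E L_E => dt.
exact: (casimir_ehop (@Fock_ind C) (@mulv_linear C) (@dv_linear C) (@mulq_linear C)
  (@eulerq_linear C) (@mulv_basis C) (@dv_basis C) (@mulq_basis C) (@eulerq_basis C)
  tens_linl tens_linr p r (diag_lin _) dt).
Qed.

Lemma Omega_f n w : Omega k 0 (diag (f_ k n) w) = diag (f_ k n) (Omega k 0 w).
Proof.
have lx := field_lin n ff; apply: (Omega_comm lx) => p r.
have dt p' r' := diag_tens p' r' lx; move: dt; rewrite e_E f_E h_E L_E => dt.
exact: (casimir_fhop (@Fock_ind C) (@mulv_linear C) (@dv_linear C) (@mulq_linear C)
  (@eulerq_linear C) (@mulv_basis C) (@dv_basis C) (@mulq_basis C) (@eulerq_basis C)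
  tens_linl tens_linr p r (diag_lin _) dt).
Qed.

Lemma Omega_h n w : Omega k 0 (diag (h_ k n) w) = diag (h_ k n) (Omega k 0 w).
Proof.
have lx := field_lin n fh; apply: (Omega_comm lx) => p r.
have dt p' r' := diag_tens p' r' lx; move: dt; rewrite e_E f_E h_E L_E => dt.
exact: (casimir_hhop (@Fock_ind C) (@mulv_linear C) (@dv_linear C) (@mulq_linear C)
  (@eulerq_linear C) (@mulv_basis C) (@dv_basis C) (@mulq_basis C) (@eulerq_basis C)
  tens_linl tens_linr p r (diag_lin _) dt).
Qed.

Lemma Omega_vac : Omega k 0 (tens vac vac) = 0.
Proof.
rewrite Omega_tens e_E f_E h_E L_E.
exact: (casimir_vac (@Fock_ind C) (@mulv_linear C) (@dv_linear C) (@mulq_linear C)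
  (@eulerq_linear C) (@mulv_basis C) (@dv_basis C) (@eulerq_basis C) k
  tens_linl tens_linr).
Qed.

Lemma Omega_submodule w : submodule k (tens vac vac) w -> Omega k 0 w = 0.
Proof.
elim=> [|a u v _ Hu _ Hv|n u _ Hu|n u _ Hu|n u _ Hu]; first exact: Omega_vac.
- by rewrite Omega_lin Hu Hv scaler0 addr0.
- by rewrite Omega_e Hu (lin0 (diag_lin _)).
- by rewrite Omega_f Hu (lin0 (diag_lin _)).
- by rewrite Omega_h Hu (lin0 (diag_lin _)).
Qed.

End Tensor.

Theorem corollary3p2 (R : realType) (k : R[i]) (tau : Fock R[i]) :
  inB k tau ->
  submodule k (tens vac vac) (tens tau tau) ->
  Omega k 0 (tens tau tau) = 0.
Proof. by move=> _; exact: Omega_submodule. Qed.
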